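(* Let $\alpha>1$, $m_0\in\mathcal P_\alpha(\mathbb R^d)$, $R\ge R(\alpha,[m_0]_\alpha)$, let $\eta\in\mathcal P_{m_0}(\Gamma_T,R)$ be a Mean Field Games equilibrium for $m_0$, and let $V$ be the value function associated with $\eta$. Then $V$ is locally Lipschitz continuous on $[0,T]\times\mathbb R^d$.
   Context: Data: $T>0$; real matrices $A$ ($d\times d$) and $B$ ($d\times k$). $\mathcal P_p(\mathbb R^d)$ is the set of Borel probability measures on $\mathbb R^d$ with finite $p$-th moment and $d_1$ is the Kantorovich–Rubinstein (1-Wasserstein) distance. $L:\mathbb R^d\times\mathbb R^k\times\mathcal P_1(\mathbb R^d)\to\mathbb R$ and $G:\mathbb R^d\times\mathcal P_1(\mathbb R^d)\to\mathbb R$ satisfy the standing assumptions: (1) for each $m$, $(x,u)\mapsto L(x,u,m)$ is $C^2$, and $m\mapsto L(x,u,m)$ is $d_1$-Lipschitz with a constant independent of $(x,u)$; (2) $G$ is bounded and uniformly continuous on $\mathbb R^d\times\mathcal P_1(\mathbb R^d)$, and for each $m$, $x\mapsto G(x,m)$ is in $C^1_b(\mathbb R^d)$ (bounded with bounded uniformly continuous first derivatives); (3) there are constants $C_0>0$, $C_1,C_2\ge0$ such that for all $(x,u,m)$: $\frac{1}{C_0}\mathrm{Id}\le D^2_{uu}L(x,u,m)\le C_0\mathrm{Id}$, $\|D^2_{xu}L(x,u,m)\|\le C_1(1+|u|)$, and $|L(x,0,m)|+|D_xL(x,0,m)|+|D_uL(x,0,m)|\le C_2$. For $x\in\mathbb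 R^d$ and $u\in L^1(0,T;\mathbb R^k)$, $\gamma(\cdot;x,u)$ is the solution of $\dot\gamma=A\gamma+Bu$ on $[0,T]$, $\gamma(0)=x$. $\Gamma_T$ is the set of all such curves, with the uniform norm, and $e_t(\gamma)=\gamma(t)$. Let $[m_0]_\alpha=\int|x|^\alpha\,m_0(dx)$. For $R\ge[m_0]_\alpha$, $$\mathcal P_{m_0}(\Gamma_T,R)=\Big\{\eta\in\mathcal P(\Gamma_T):\int_{\Gamma_T}\|\dot\gamma\|_{2}^\alpha\,\eta(d\gamma)\le R,\ e_0\sharp\eta=m_0\Big\},$$ where $\|\cdot\|_2$ is the $L^2(0,T)$ norm. For $\eta$ in this set, let $m^\eta_t=e_t\sharp\eta$, $J_\eta(x,u)=\int_0^TL(\gamma(t;x,u),u(t),m^\eta_t)\,dt+G(\gamma(T;x,u),m^\eta_T)$, and let $\Gamma^*_\eta(x)$ be the set of curves $\gamma(\cdot;x,u^* )$ where $u^*$ minimizes $J_\eta(x,\cdot)$ over $L^2(0,T;\mathbb R^k)$. A Mean Field Games equilibrium for $m_0$ is an $\eta\in\mathcal P_{m_0}(\Gamma_T,R)$ with $\operatorname{supp}(\eta)\subset\bigcup_{x\in\mathbb R^d}\Gamma^*_\eta(x)$. The value function associated with $\eta$ is $$V(t,x)=\inf_{u\in L^2(t,T;\mathbb R^k)}\Big\{\int_t^TL(\gamma(s;t,x,u),u(s),m^\eta_s)\,ds+G(\gamma(T;t,x,u),m^\eta_T)\Big\},$$ where $\gamma(\cdot;t,x,u)$ solves $\dot\gamma=A\gamma+Bu$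 on $[t,T]$, $\gamma(t)=x$. $R(\alpha,[m_0]_\alpha)\ge[m_0]_\alpha$ denotes a positive constant such that, for every $R\ge R(\alpha,[m_0]_\alpha)$, the set $\mathcal P_{m_0}(\Gamma_T,R)$ is non-empty and for every $\eta$ in it there is $\nu\in\mathcal P_{m_0}(\Gamma_T,R)$ whose disintegration $\nu(d\gamma)=\int\nu_x(d\gamma)m_0(dx)$ with respect to $e_0$ satisfies $\operatorname{supp}(\nu_x)\subset\Gamma^*_\eta(x)$ for $m_0$-a.e. $x$ (such a constant exists). *)

(* Defs.v *)
From HB Require Import structures.
From mathcomp Require Import all_boot all_order all_algebra.
From mathcomp Require Import all_classical all_reals all_analysis.

Set Implicit Arguments.
Unset Strict Implicit.
Unset Printing Implicit Defensive.
Import Order.TTheory GRing.Theory Num.Theory.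
Import numFieldNormedType.Exports.

Local Open Scope classical_set_scope.
Local Open Scope ring_scope.

Definition enorm {R : realType} {n : nat} (x : 'cV[R]_n) : R :=
  Num.sqrt (\sum_i x i 0 ^+ 2).

Definition opnorm {R : realType} {m n : nat} (M : 'M[R]_(m, n)) : R :=
  sup [set enorm (M *m v) | v in [set v : 'cV[R]_n | enorm v <= 1]].

Definition loewner_le {R : realType} {n : nat} (M N : 'M[R]_n) : Prop :=
  forall v : 'cV[R]_n, (v^T *m M *m v) 0 0 <= (v^T *m N *m v) 0 0.

Definition ebase {R : realType} {n : nat} (i : 'I_n) : 'cV[R]_n := delta_mx i 0.

Definition grad {R : realType} {n : nat} (f : 'cV[R]_n -> R) (x : 'cV[R]_n) :
    'cV[R]_n :=
  \col_i 'D_(ebase i) f x.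

Definition hessian {R : realType} {n : nat} (f : 'cV[R]_n -> R)
    (x : 'cV[R]_n) : 'M[R]_n :=
  \matrix_(i, j) 'D_(ebase i) ('D_(ebase j) f) x.

Definition mixed_hessian {R : realType} {n p : nat}
    (f : 'cV[R]_n -> 'cV[R]_p -> R) (x : 'cV[R]_n) (u : 'cV[R]_p) :
    'M[R]_(n, p) :=
  \matrix_(i, j) 'D_(ebase i) (fun y => 'D_(ebase j) (f y) u) x.

Definition is_C1 {R : realType} {E : normedModType R} (f : E -> R) : Prop :=
  (forall x, differentiable f x) /\ (forall v, continuous ('D_v f)).

Definition is_C2 {R : realType} {E : normedModType R} (f : E -> R) : Prop :=
  is_C1 f /\ (forall v, is_C1 ('D_v f)).

Definition is_C1b {R : realType} {n : nat} (f : 'cV[R]_n -> R) : Prop :=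
  [/\ forall x, differentiable f x,
      exists M : R, forall x, `|f x| <= M,
      exists M : R, forall x, enorm (grad f x) <= M
    & unif_continuous (grad f)].

Notation borel E := (g_sigma_algebraType (@open E%type)).

Definition supp {R : realType} {E : ptopologicalType}
    (mu : {measure set (borel E) -> \bar R}) : set E :=
  [set x | forall U : set E, open U -> U x -> (0 < mu U)%E].

Section Wasserstein.
Context {R : realType} {n : nat}.
Notation Rn := (borel 'cV[R]_n).
Implicit Types m : probability Rn R.

Definition moment (p : R) m : \bar R := (\int[m]_x (enorm x `^ p)%:E)%E.

Definition in_Pp (p : R) m : Prop := (moment p m < +oo)%E.

Definition coupling m1 m2 : set (probability (Rn * Rn)%type R) :=
  [set pi | (forall S : set Rn, measurable S -> pi (fst @^-1` S) = m1 S) /\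
            (forall S : set Rn, measurable S -> pi (snd @^-1` S) = m2 S)].

(* Kantorovich-Rubinstein distance, as the 1-Wasserstein distance. *)
Definition dist1 m1 m2 : \bar R :=
  ereal_inf [set (\int[pi]_z (enorm (z.1 - z.2))%:E)%E | pi in coupling m1 m2].

End Wasserstein.

Definition in_Lp {R : realType} {k : nat} (p a b : R) (u : R -> 'cV[R]_k) :
    Prop :=
  measurable_fun `[a, b] (u : R -> borel 'cV[R]_k) /\
  (\int[lebesgue_measure]_(s in `[a, b]) (enorm (u s) `^ p)%:E < +oo)%E.

(* Caratheodory solution of g' = A g + B u on [t, T] with g(t) = x, for an
   integrable control u, in integral form. *)
Definition trajectory {R : realType} {d k : nat} (A : 'M[R]_d)
    (B : 'M[R]_(d, k)) (t T : R) (x : 'cV[R]_d) (u : R -> 'cV[R]_k)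
    (g : R -> 'cV[R]_d) : Prop :=
  {within `[t, T], continuous g} /\
  forall s, s \in `[t, T] -> forall i,
    g s i 0 = x i 0 +
      \int[lebesgue_measure]_(r in `[t, s]) (A *m g r + B *m u r) i 0.

(* A curve on [0, T] is encoded by its extension to R that is constant on each
   side of [0, T]; the topology is that of uniform convergence on [0, T]. *)
Definition clamp {R : realType} (T t : R) : R := Num.max 0 (Num.min t T).

Definition Gamma {R : realType} {d k : nat} (A : 'M[R]_d) (B : 'M[R]_(d, k))
    (T : {posnum R}) : set {uniform` `[0, T%:num] -> 'cV[R]_d} :=
  [set g | (exists x u, in_Lp 1 0 T%:num u /\
                        trajectory A B 0 T%:num x u g) /\
           (forall t, g t = g (clamp T%:num t))].
Arguments Gamma {R d k} A B T.

Definition curve {R : realType} {d k : nat} (A : 'M[R]_d) (B : 'M[R]_(d, k))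
    (T : {posnum R}) : Type := set_type (Gamma A B T).

Section Curves.
Context {R : realType} {d k : nat} {A : 'M[R]_d} {B : 'M[R]_(d, k)}.
Context {T : {posnum R}}.

HB.instance Definition _ := Uniform.on (curve A B T).

Definition curve_fun (g : curve A B T) : R -> 'cV[R]_d := set_val g.

Lemma Gamma_cst0 : Gamma A B T (fun=> 0).
Proof.
split=> //; exists 0, (fun=> 0); split.
  split; first exact: measurable_cst.
  rewrite integral0_eq// => s _; rewrite /enorm big1 ?sqrtr0 ?powR0 ?oner_eq0//.
  by move=> i _; rewrite mxE expr0n.
split; first exact: cst_continuous.
move=> s _ i.
have -> : (fun r : R => (A *m (0 : 'cV[R]_d) + B *m (0 : 'cV[R]_k)) i 0)
  = cst 0 by apply/funext => r; rewrite !mulmx0 addr0 mxE.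
by rewrite Rintegral_cst// mul0r addr0.
Qed.

HB.instance Definition _ :=
  isPointed.Build (curve A B T) (SigSub (mem_set Gamma_cst0) : curve A B T).

Definition e_ (t : R) (g : borel (curve A B T)) : borel 'cV[R]_d :=
  curve_fun g t.

Lemma e_continuous (t : R) : continuous (fun g : curve A B T => curve_fun g t).
Proof.
pose s := clamp T%:num t.
have sT : `[0, T%:num]%classic s.
  by rewrite /= in_itv /= /s /clamp le_max lexx /= ge_max ge_min lexx orbT ltW.
have gE (g : curve A B T) : curve_fun g t = curve_fun g s.
  by have /set_mem[_] := valP g; exact.
have -> : (fun g : curve A B T => curve_fun g t) = curve_fun^~ s.
  by apply/funext => g; exact: gE.
move=> g; have cg : {uniform `[0, T%:num], curve_fun @ nbhs g --> curve_fun g}.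
  exact: (@initial_continuous (curve A B T) _ set_val g).
have sub : [set s] `<=` `[0, T%:num] by move=> _ ->.
have Fg : Filter (curve_fun @ nbhs g) by exact: fmap_filter.
by have := uniform_subset_cvg Fg sub cg; rewrite uniform_set1.
Qed.

Lemma measurable_e_ (t : R) : measurable_fun setT (e_ t).
Proof.
pose G := @open 'cV[R]_d : set (set (borel 'cV[R]_d)).
apply: (@measurability _ _ _ _ _ _ G) => //.
move=> _ [U oU <-]; rewrite setTI; apply: sub_sigma_algebra.
by have /continuousP := @e_continuous t; exact.
Qed.

HB.instance Definition _ (t : R) :=
  isMeasurableFun.Build _ _ _ _ (e_ t) (measurable_e_ t).

Definition flow (eta : probability (borel (curve A B T)) R) (t : R) :
  probability (borel 'cV[R]_d) R := distribution eta (e_ t).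

(* A curve is absolutely continuous, so its pointwise derivative exists a.e. on
   [0, T]; the result may be +oo. *)
Definition speed2 (g : curve A B T) : \bar R :=
  ((\int[lebesgue_measure]_(t in `[0%R, T%:num])
      (enorm (derive1 (curve_fun g) t) ^+ 2)%:E) `^ 2^-1)%E.

End Curves.

(* [L] and [G] are total in the measure variable, standing for arbitrary
   extensions of functions given on P_1: only their values on P_1 are
   constrained, and the flow of an element of [P_m0] stays in P_1. *)
Record standing_assumptions {R : realType} {d k : nat}
    (L : 'cV[R]_d -> 'cV[R]_k -> probability (borel 'cV[R]_d) R -> R)
    (G : 'cV[R]_d -> probability (borel 'cV[R]_d) R -> R)
    (C0 C1 C2 : R) : Prop := {
  L_C2 : forall m, in_Pp 1 m ->
    is_C2 (fun z : 'cV[R]_d * 'cV[R]_k => L z.1 z.2 m);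
  L_lipschitz : exists K : R, forall x u m m', in_Pp 1 m -> in_Pp 1 m' ->
    (`|L x u m - L x u m'|%:E <= K%:E * dist1 m m')%E;
  G_bounded : exists M : R, forall x m, in_Pp 1 m -> `|G x m| <= M;
  G_unif_continuous : forall e : R, 0 < e -> exists2 r : R, 0 < r &
    forall x x' m m', in_Pp 1 m -> in_Pp 1 m' ->
      enorm (x - x') < r -> (dist1 m m' < r%:E)%E -> `|G x m - G x' m'| < e;
  G_C1b : forall m, in_Pp 1 m -> is_C1b (G ^~ m);
  C0_gt0 : 0 < C0;
  C1_ge0 : 0 <= C1;
  C2_ge0 : 0 <= C2;
  L_uu : forall x u m, in_Pp 1 m ->
    loewner_le (C0^-1)%:M (hessian (fun v => L x v m) u) /\
    loewner_le (hessian (fun v => L x v m) u) C0%:M;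
  L_xu : forall x u m, in_Pp 1 m ->
    opnorm (mixed_hessian (fun y v => L y v m) x u) <= C1 * (1 + enorm u);
  L_0 : forall x m, in_Pp 1 m ->
    `|L x 0 m| + enorm (grad (fun y => L y 0 m) x)
      + enorm (grad (fun v => L x v m) 0) <= C2
}.

Section MFG.
Context {R : realType} {d k : nat} (A : 'M[R]_d) (B : 'M[R]_(d, k)).
Context (T : {posnum R}).
Context (L : 'cV[R]_d -> 'cV[R]_k -> probability (borel 'cV[R]_d) R -> R).
Context (G : 'cV[R]_d -> probability (borel 'cV[R]_d) R -> R).

Notation Rd := (borel 'cV[R]_d).
Notation GammaT := (borel (curve A B T)).
Implicit Types eta : probability GammaT R.

Definition P_m0 (alpha : R) (m0 : probability Rd R) (r : R) :
    set (probability GammaT R) :=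
  [set eta : probability GammaT R |
    (\int[eta]_g (speed2 g `^ alpha) <= r%:E)%E /\
    forall S : set Rd, measurable S -> flow eta 0 S = m0 S].

Definition cost eta (t : R) (u : R -> 'cV[R]_k) (g : R -> 'cV[R]_d) : \bar R :=
  (\int[lebesgue_measure]_(s in `[t, T%:num]) (L (g s) (u s) (flow eta s))%:E
    + (G (g T%:num) (flow eta T%:num))%:E)%E.

Definition optimal_curves eta (x : 'cV[R]_d) : set (curve A B T) :=
  [set g | exists u, [/\ in_Lp 2 0 T%:num u,
      trajectory A B 0 T%:num x u (curve_fun g)
    & forall v h, in_Lp 2 0 T%:num v -> trajectory A B 0 T%:num x v h ->
        (cost eta 0 u (curve_fun g) <= cost eta 0 v h)%E]].

Definition equilibrium (alpha : R) (m0 : probability Rd R) (r : R) eta : Prop :=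
  P_m0 alpha m0 r eta /\
  supp eta `<=` \bigcup_(x in [set: 'cV[R]_d]) optimal_curves eta x.

Definition value_function eta (t : R) (x : 'cV[R]_d) : \bar R :=
  ereal_inf [set c | exists u g, [/\ in_Lp 2 t T%:num u,
    trajectory A B t T%:num x u g & c = cost eta t u g]].

Definition disintegration (nu : probability GammaT R)
    (m0 : probability Rd R) (kappa : R.-pker Rd ~> GammaT) : Prop :=
  (forall S : set GammaT, measurable S ->
     nu S = (\int[m0]_x kappa x S)%E) /\
  {ae m0, forall x, kappa x [set g | curve_fun g 0 = x] = 1%E}.

(* [r0] can be taken as the constant R(alpha, [m0]_alpha). *)
Definition admissible_radius (alpha : R) (m0 : probability Rd R) (r0 : R) :
    Prop :=
  [/\ 0 < r0, (moment alpha m0 <= r0%:E)%E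
    & forall r, r0 <= r ->
        P_m0 alpha m0 r !=set0 /\
        forall eta, P_m0 alpha m0 r eta ->
          exists2 nu : probability GammaT R, P_m0 alpha m0 r nu &
          exists2 kappa : R.-pker Rd ~> GammaT, disintegration nu m0 kappa &
          {ae m0, forall x, supp (kappa x) `<=` optimal_curves eta x}].

End MFG.

Definition locally_lipschitz {R : realType} {E : normedModType R}
    (D : set E) (f : E -> \bar R) : Prop :=
  (forall p, D p -> f p \is a fin_num) /\
  forall p, D p -> exists2 U, nbhs p U &
    [lipschitz fine (f q) | q in U `&` D].

(* Main.v *)
(** Only near-optimal controls are needed. The bounds on [D^2_uu L] squeeze the
    running cost between [c |u|^2 - C] and [C (1 + |u|^2)], so controls whose
    cost is within 1 of the infimum are bounded in [L^2] uniformly in the initial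
    datum. Keeping such a control while moving the initial point from [x] to [y]
    changes the cost by [O(|x - y|)], because
    [|L(x,u,m) - L(y,u,m)| <= C (1 + |u|^2) |x - y|]; hence [V(t, .)] is Lipschitz.
    In time, let [t < t']. Waiting with zero control until [t'] gives
    [V(t,x) <= V(t',x) + O(t' - t)]. Conversely, a near-optimal control for [(t,x)]
    displaces the state by at most [O(t' - t) + O(int_t^t' |u|)] on [[t, t']], and
    the last term is absorbed by [c int_t^t' |u|^2].
    The bound on [int ||g'||_2^alpha] puts the marginals [m_t] in [P_1] and makes
    [t |-> m_t] 1/2-Hoelder for [d_1], so that the running cost along a trajectory
    is measurable in time. *)

Require Import Defs.
From mathcomp Require Import all_boot all_order all_algebra.
From mathcomp Require Import all_classical all_reals all_analysis.
From mathcomp Require Import measurable_realfun.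
From mathcomp Require Import ring lra.
Import Order.TTheory GRing.Theory Num.Theory.
Import numFieldNormedType.Exports.
Local Open Scope classical_set_scope.
Local Open Scope ring_scope.
Set Implicit Arguments.
Unset Strict Implicit.
Unset Printing Implicit Defensive.

(** * Norms and second-order estimates *)

Section euclidean_norm.
Context {R : realType}.

Lemma enorm_ge0 n (x : 'cV[R]_n) : 0 <= enorm x.
Proof. exact: sqrtr_ge0. Qed.

Lemma sqr_enorm n (x : 'cV[R]_n) : enorm x ^+ 2 = \sum_i x i 0 ^+ 2.
Proof. by rewrite sqr_sqrtr// sumr_ge0// => i _; exact: sqr_ge0. Qed.

Lemma coord_le_enorm n (x : 'cV[R]_n) i : `|x i 0| <= enorm x.
Proof.
rewrite -sqrtr_sqr ler_sqrt ?sumr_ge0// => [|j _]; last exact: sqr_ge0.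
by rewrite (bigD1 i)//= lerDl sumr_ge0// => j _; exact: sqr_ge0.
Qed.

Lemma enorm_le_sum n (x : 'cV[R]_n) : enorm x <= \sum_i `|x i 0|.
Proof.
have s0 : 0 <= \sum_i `|x i 0| by exact: sumr_ge0.
rewrite -[leRHS]ger0_norm// -sqrtr_sqr ler_sqrt ?sqr_ge0//.
rewrite expr2 mulr_suml ler_sum// => i _.
by rewrite -real_normK ?num_real// expr2 ler_wpM2l// (bigD1 i)//= lerDl sumr_ge0.
Qed.

Lemma enormZ n (a : R) (x : 'cV[R]_n) : enorm (a *: x) = `|a| * enorm x.
Proof.
rewrite /enorm -sqrtr_sqr -sqrtrM ?sqr_ge0// mulr_sumr.
by congr Num.sqrt; apply: eq_bigr => i _; rewrite mxE exprMn.
Qed.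

Lemma enorm0 n : enorm (0 : 'cV[R]_n) = 0.
Proof. by rewrite -(scale0r 0) enormZ normr0 mul0r. Qed.

Lemma coord_le_norm n (x : 'cV[R]_n) i : `|x i 0| <= `|x|.
Proof. by rewrite [leRHS]mx_normrE; exact: (le_bigmax _ _ (i, 0)). Qed.

Lemma norm_le_of_coord n (x : 'cV[R]_n) (c : R) :
  0 <= c -> (forall i, `|x i 0| <= c) -> `|x| <= c.
Proof.
move=> c0 xc; rewrite [leLHS]mx_normrE bigmax_le// => -[i j] _ /=.
by rewrite (ord1 j).
Qed.

Lemma norm_le_enorm n (x : 'cV[R]_n) : `|x| <= enorm x.
Proof.
apply: norm_le_of_coord => [|i]; first exact: enorm_ge0.
exact: coord_le_enorm.
Qed.

Lemma enorm_mulmx_le_sum n p (M : 'M[R]_(n, p)) (v : 'cV[R]_p) :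
  enorm (M *m v) <= (\sum_i \sum_j `|M i j|) * enorm v.
Proof.
apply: (le_trans (enorm_le_sum _)); rewrite mulr_suml ler_sum// => i _.
rewrite mxE mulr_suml (le_trans (ler_norm_sum _ _ _))// ler_sum// => j _.
by rewrite normrM ler_wpM2l// coord_le_enorm.
Qed.

Lemma enorm_mulmx n p (M : 'M[R]_(n, p)) (v : 'cV[R]_p) :
  enorm (M *m v) <= opnorm M * enorm v.
Proof.
have ub : has_sup [set enorm (M *m w) | w in [set w : 'cV[R]_p | enorm w <= 1]].
  split; first by exists (enorm (M *m 0)); exists 0 => //=; rewrite enorm0.
  exists (\sum_i \sum_j `|M i j|) => _ [w /= w1 <-].
  rewrite (le_trans (enorm_mulmx_le_sum _ _))// -[leRHS]mulr1 ler_wpM2l//.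
  by rewrite sumr_ge0// => i _; rewrite sumr_ge0.
have [v0|v0] := eqVneq (enorm v) 0.
  rewrite v0 mulr0 (le_trans (enorm_mulmx_le_sum _ _))// v0 mulr0//.
have vp : 0 < enorm v by rewrite lt_def v0 enorm_ge0.
rewrite -ler_pdivrMr// mulrC -[X in X * _]ger0_norm ?invr_ge0 ?enorm_ge0//.
rewrite -enormZ scalemxAr; apply: ub_le_sup; first by case: ub.
exists ((enorm v)^-1 *: v) => //=.
by rewrite enormZ ger0_norm ?invr_ge0 ?enorm_ge0// mulVf.
Qed.

Lemma col_sum_ebase n (v : 'cV[R]_n) : v = \sum_i v i 0 *: ebase i.
Proof.
apply/colP => i; rewrite summxE (bigD1 i)//= big1 => [|j ji].
  by rewrite !mxE !eqxx mulr1 addr0.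
by rewrite !mxE eq_sym (negbTE ji) mulr0.
Qed.

End euclidean_norm.

Section directional_derivatives.
Context {R : realType}.

Lemma derive_line {E : normedModType R} (f : E -> R) (a v : E) (s : R) :
  differentiable f (a + s *: v) ->
  is_derive s 1 (fun t => f (a + t *: v)) ('D_v f (a + s *: v)).
Proof.
move=> df; have dv : derivable f (a + s *: v) v by exact: diff_derivable.
have E1 : (fun h : R => h^-1 *: (f (a + (h *: (1 : R) + s) *: v) - f (a + s *: v)))
   = (fun h : R => h^-1 *: (f (h *: v + (a + s *: v)) - f (a + s *: v))).
  by apply/funext => h; rewrite [h *: 1]mulr1 scalerDl addrCA.
split; first by rewrite /derivable; move: dv; rewrite /derivable -E1.
by rewrite /derive -E1.
Qed.

Lemma MVT_line {E : normedModType R} (f : E -> R) (a v : E) :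
  (forall x, differentiable f x) ->
  exists2 c : R, 0 <= c <= 1 & f (a + v) - f a = 'D_v f (a + c *: v).
Proof.
move=> df.
have [||c c01 E1] := @MVT_segment R (fun t => f (a + t *: v))
    (fun t => 'D_v f (a + t *: v)) 0 1 ler01.
- by move=> t _; exact: derive_line.
- apply: continuous_subspaceT => t; apply: differentiable_continuous.
  by apply/derivable1_diffP; have [] := derive_line (df (a + t *: v)).
exists c; first by move: c01; rewrite in_itv.
by move: E1; rewrite scale1r scale0r addr0 subr0 mulr1.
Qed.

Lemma derive_sum_dir {E : normedModType R} (f : E -> R) (a : E) n
    (c : 'I_n -> R) (v : 'I_n -> E) : differentiable f a ->
  'D_(\sum_i c i *: v i) f a = \sum_i c i * 'D_(v i) f a.
Proof.
move=> df; rewrite deriveE// linear_sum; apply: eq_bigr => i _.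
by rewrite linearZ deriveE.
Qed.

Lemma derive_ebase n (f : 'cV[R]_n -> R) (a v : 'cV[R]_n) :
  differentiable f a -> 'D_v f a = \sum_i v i 0 * 'D_(ebase i) f a.
Proof. by move=> df; rewrite {1}(col_sum_ebase v) derive_sum_dir. Qed.

Lemma derive_le_grad n (f : 'cV[R]_n -> R) (a v : 'cV[R]_n) :
  differentiable f a -> `|'D_v f a| <= n%:R * `|v| * enorm (grad f a).
Proof.
move=> df; rewrite derive_ebase// (le_trans (ler_norm_sum _ _ _))//.
rewrite -mulrA (_ : n%:R * _ = \sum_(i < n) (`|v| * enorm (grad f a))); last first.
  by rewrite sumr_const card_ord mulr_natl.
rewrite ler_sum// => i _; rewrite normrM ler_pM ?coord_le_norm//.
by have := coord_le_enorm (grad f a) i; rewrite mxE.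
Qed.

Lemma grad_bound_lipschitz n (f : 'cV[R]_n -> R) (M : R) :
  (forall x, differentiable f x) -> (forall x, enorm (grad f x) <= M) ->
  forall x y, `|f x - f y| <= n%:R * M * `|x - y|.
Proof.
move=> df gM x y; have [c _] := MVT_line y (x - y) df.
rewrite addrCA subrr addr0 => ->.
rewrite (le_trans (derive_le_grad _ (df _)))// mulrAC ler_wpM2r//.
by rewrite ler_wpM2l.
Qed.

End directional_derivatives.

Section second_order.
Context {R : realType}.

Lemma taylor2_ge (g g' g'' : R -> R) (a : R) :
  (forall s : R, is_derive s (1:R) g (g' s)) -> (forall s : R, is_derive s (1:R) g' (g'' s)) ->
  (forall s, a <= g'' s) -> g 0 + g' 0 + a / 2 <= g 1.
Proof.
move=> dg dg' ag.
pose h s := g s - s * g' 0 - s ^+ 2 * (a / 2).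
pose h' s := g' s - g' 0 - s * a.
have dh (s : R) : is_derive s (1:R) h (h' s).
  have dgs := dg s; rewrite /h; apply: is_derive_eq.
  by rewrite /h' /GRing.scale/= !(mulr1,mul1r,mulr0,addr0,scaler0); field.
have der_cont (f f' : R -> R) (A : set R) : (forall s : R, is_derive s (1:R) f (f' s)) ->
    {within A, continuous f}.
  move=> df; apply: continuous_subspaceT => t.
  by apply: differentiable_continuous; apply/derivable1_diffP; have [] := df t.
have h'0 s : 0 <= s -> 0 <= h' s.
  move=> s0; have [|c cs E1] := @MVT_segment R g' g'' 0 s s0.
    exact: der_cont dg'.
  by rewrite /h' E1 subr0 [s * a]mulrC -mulrBl mulr_ge0// subr_ge0.
have [|c cs E1] := @MVT_segment R h h' 0 1 ler01.
  exact: der_cont dh.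
have c0 : 0 <= c by move: cs; rewrite in_itv => /andP[].
have : 0 <= h 1 - h 0 by rewrite E1 subr0 mulr1 h'0.
by rewrite /h; lra.
Qed.

Lemma derive_derive_hessian n (f : 'cV[R]_n -> R) (w v : 'cV[R]_n) :
  (forall x, differentiable f x) ->
  (forall u x, differentiable ('D_u f) x) ->
  'D_v ('D_v f) w = (v^T *m hessian f w *m v) 0 0.
Proof.
move=> df d2f; rewrite derive_ebase// mxE.
transitivity (\sum_i \sum_j v i 0 * v j 0 * 'D_(ebase i) ('D_(ebase j) f) w).
  apply: eq_bigr => i _.
  have -> : 'D_v f = \sum_j (fun x => v j 0 * 'D_(ebase j) f x).
    by apply/funext => x; rewrite fct_sumE derive_ebase.
  rewrite derive_sum; last first.
    by move=> j; apply: derivableZ; exact: diff_derivable.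
  rewrite mulr_sumr; apply: eq_bigr => j _.
  by rewrite deriveZ ?mulrA//; exact: diff_derivable.
rewrite exchange_big/=; apply: eq_bigr => j _.
rewrite mxE mulr_suml; apply: eq_bigr => i _.
by rewrite !mxE; ring.
Qed.

Lemma taylor2_hessian_ge n (f : 'cV[R]_n -> R) (c : R) (v : 'cV[R]_n) :
  (forall x, differentiable f x) ->
  (forall u x, differentiable ('D_u f) x) ->
  (forall x, loewner_le c%:M (hessian f x)) ->
  f 0 + 'D_v f 0 + c * enorm v ^+ 2 / 2 <= f v.
Proof.
move=> df d2f cf.
have E0 s : 0 + s *: v = s *: v by rewrite add0r.
have := @taylor2_ge (fun s => f (0 + s *: v)) (fun s => 'D_v f (0 + s *: v))
  (fun s => 'D_v ('D_v f) (0 + s *: v)) (c * enorm v ^+ 2).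
rewrite !E0 scale0r scale1r; apply=> s.
- exact: derive_line.
- exact: derive_line.
rewrite derive_derive_hessian//; apply: le_trans (cf _ v).
rewrite mul_mx_scalar -scalemxAl !mxE sqr_enorm le_eqVlt; apply/orP; left.
by apply/eqP; congr (_ * _); apply: eq_bigr => i _; rewrite mxE expr2.
Qed.

Lemma taylor2_hessian_le n (f : 'cV[R]_n -> R) (c : R) (v : 'cV[R]_n) :
  (forall x, differentiable f x) ->
  (forall u x, differentiable ('D_u f) x) ->
  (forall x, loewner_le (hessian f x) c%:M) ->
  f v <= f 0 + 'D_v f 0 + c * enorm v ^+ 2 / 2.
Proof.
move=> df d2f cf.
have E0 s : 0 + s *: v = s *: v by rewrite add0r.
have := @taylor2_ge (fun s => - f (0 + s *: v)) (fun s => - 'D_v f (0 + s *: v))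
  (fun s => - 'D_v ('D_v f) (0 + s *: v)) (- (c * enorm v ^+ 2)).
rewrite !E0 scale0r scale1r => H; 
rewrite -lerN2 (le_trans _ (H _ _ _))//; first lra.
- by move=> s; apply: is_deriveN; exact: derive_line.
- by move=> s; apply: is_deriveN; exact: derive_line.
move=> s; rewrite lerN2.
rewrite derive_derive_hessian//; apply: (le_trans (cf _ v)).
rewrite mul_mx_scalar -scalemxAl !mxE sqr_enorm le_eqVlt; apply/orP; left.
by apply/eqP; congr (_ * _); apply: eq_bigr => i _; rewrite mxE expr2.
Qed.

End second_order.

Section partial_derivatives.
Context {R : realType} {V W : normedModType R}.
Implicit Types (f : V -> W -> R).

Lemma differentiable_uncurry_r f x u :
  differentiable (fun z : V * W => f z.1 z.2) (x, u) -> differentiable (f x) u.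
Proof.
move=> df; rewrite (_ : f x = (fun z : V * W => f z.1 z.2) \o (fun w => (x, w)))//.
by apply: differentiable_comp => //; apply: differentiable_pair.
Qed.

Lemma differentiable_uncurry_l f x u :
  differentiable (fun z : V * W => f z.1 z.2) (x, u) -> differentiable (f ^~ u) x.
Proof.
move=> df; rewrite (_ : f ^~ u = (fun z : V * W => f z.1 z.2) \o (fun w => (w, u)))//.
by apply: differentiable_comp => //; apply: differentiable_pair.
Qed.

Lemma derive_uncurry_r f x u w :
  'D_w (f x) u = 'D_((0, w) : V * W) (fun z : V * W => f z.1 z.2) (x, u).
Proof.
rewrite /derive.
set F := (X in lim (X @ _) = _); set G := (X in _ = lim (X @ _)).
suff -> : F = G by [].
by apply/funext => h; rewrite /F /G/= scaler0 add0r.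
Qed.

End partial_derivatives.

Section C2_bounds.
Context {R : realType} {d k : nat} (f : 'cV[R]_d -> 'cV[R]_k -> R).
Hypothesis f2 : is_C2 (fun z : 'cV[R]_d * 'cV[R]_k => f z.1 z.2).

Let dr x u : differentiable (f x) u.
Proof. by apply: (differentiable_uncurry_r (f := f)); case: f2 => -[]. Qed.

Let dl x u : differentiable (f ^~ u) x.
Proof.
by apply: (differentiable_uncurry_l (f := f)); case: f2 => -[].
Qed.

Let deriv2 (w : 'cV[R]_k) (z : 'cV[R]_d * 'cV[R]_k) :
  differentiable (fun z : 'cV[R]_d * 'cV[R]_k => 'D_w (f z.1) z.2) z.
Proof.
case: f2 => _ /(_ (0, w))[+ _] => /(_ z).
congr (differentiable _ _); apply/funext => -[x u].
by rewrite derive_uncurry_r.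
Qed.

Let d2r x w u : differentiable ('D_w (f x)) u.
Proof.
exact: (differentiable_uncurry_r (f := fun x => 'D_w (f x)) (deriv2 w (x, u))).
Qed.

Let d2l w u x : differentiable (fun y => 'D_w (f y) u) x.
Proof.
exact: (differentiable_uncurry_l (f := fun x => 'D_w (f x)) (deriv2 w (x, u))).
Qed.

Lemma C2_coercive (x : 'cV[R]_d) (c : R) :
  (forall u, loewner_le c%:M (hessian (f x) u)) ->
  forall v, f x 0 - k%:R * enorm (grad (f x) 0) * enorm v + c * enorm v ^+ 2 / 2
    <= f x v.
Proof.
move=> hc v; apply: le_trans (taylor2_hessian_ge v _ _ hc) => //.
have := derive_le_grad v (dr x 0); rewrite ler_norml => /andP[+ _].
move=> /(le_trans _) H; rewrite lerD2r lerD2l; apply: H.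
by rewrite lerN2 mulrAC ler_wpM2l ?norm_le_enorm// mulr_ge0 ?enorm_ge0.
Qed.

Lemma C2_growth (x : 'cV[R]_d) (c : R) :
  (forall u, loewner_le (hessian (f x) u) c%:M) ->
  forall v, f x v <=
    f x 0 + k%:R * enorm (grad (f x) 0) * enorm v + c * enorm v ^+ 2 / 2.
Proof.
move=> hc v; apply: le_trans (taylor2_hessian_le v _ _ hc) _ => //.
have := derive_le_grad v (dr x 0); rewrite ler_norml => /andP[_ H].
rewrite lerD2r lerD2l; apply: (le_trans H).
by rewrite mulrAC ler_wpM2l ?norm_le_enorm// mulr_ge0 ?enorm_ge0.
Qed.

(* The mean value theorem is applied in [u] before [x], so that the derivatives
   come in the order of [mixed_hessian]. *)
Lemma C2_mixed_lipschitz (C : R) u :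
  (forall x v, enorm v <= enorm u -> opnorm (mixed_hessian f x v) <= C) ->
  forall x y, `|(f x u - f y u) - (f x 0 - f y 0)| <=
    d%:R * `|x - y| * (C * enorm u).
Proof.
move=> hC x y.
have [|c /andP[c0 c1]] := MVT_line (f := fun v => f x v - f y v) 0 u.
  by move=> v; apply: differentiableB.
rewrite !add0r => ->; rewrite deriveB; try exact: diff_derivable.
set v := c *: u.
have [|b _] := MVT_line (f := fun z => 'D_u (f z) v) y (x - y).
  by move=> z; exact: d2l.
rewrite addrCA subrr addr0 => ->; set z := y + b *: (x - y).
rewrite derive_ebase; last exact: d2l.
have E1 i : 'D_(ebase i) (fun z => 'D_u (f z) v) z =
    (mixed_hessian f z v *m u) i 0.
  rewrite mxE.
  have -> : (fun z => 'D_u (f z) v) =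
      \sum_j (fun z => u j 0 * 'D_(ebase j) (f z) v).
    by apply/funext => t; rewrite fct_sumE derive_ebase.
  rewrite derive_sum; last first.
    by move=> j; apply: derivableZ; exact: diff_derivable.
  apply: eq_bigr => j _; rewrite deriveZ; last exact: diff_derivable.
  by rewrite mxE mulrC.
rewrite (eq_bigr _ (fun i _ => congr1 _ (E1 i))).
rewrite (le_trans (ler_norm_sum _ _ _))//.
rewrite -mulrA (_ : d%:R * _ = \sum_(i < d) (`|x - y| * (C * enorm u))); last first.
  by rewrite sumr_const card_ord mulr_natl.
rewrite ler_sum// => i _; rewrite normrM ler_pM ?coord_le_norm//.
rewrite (le_trans (coord_le_enorm _ _))// (le_trans (enorm_mulmx _ _))//.
rewrite ler_wpM2r ?enorm_ge0// hC// /v enormZ ger0_norm//.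
by rewrite ler_piMl ?enorm_ge0.
Qed.

End C2_bounds.

(** * Bounds on the running cost *)

Lemma running_cost_bounds (R : realType) (d k : nat)
    (L : 'cV[R]_d -> 'cV[R]_k -> probability (borel 'cV[R]_d) R -> R)
    (G : 'cV[R]_d -> probability (borel 'cV[R]_d) R -> R) (C0 C1 C2 : R) :
  standing_assumptions L G C0 C1 C2 ->
  exists c C : R, [/\ 0 < c, 0 <= C & forall m, in_Pp 1 m ->
    [/\ forall x u, c * enorm u ^+ 2 - C <= L x u m,
        forall x u, `|L x u m| <= C * (1 + enorm u ^+ 2)
      & forall x y u, `|L x u m - L y u m| <=
          C * (1 + enorm u ^+ 2) * `|x - y|]].
Proof.
case=> LC2 _ _ _ _ C0p C1p C2p Luu Lxu L0.
pose q := k%:R * C2.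
have q0 : 0 <= q by rewrite mulr_ge0.
have L0' x m (m1 : in_Pp 1 m) : [/\ `|L x 0 m| <= C2,
    enorm (grad (fun y => L y 0 m) x) <= C2
  & enorm (grad (fun v => L x v m) 0) <= C2].
  have := L0 x m m1; have := normr_ge0 (L x 0 m).
  have := enorm_ge0 (grad (fun y => L y 0 m) x).
  by have := enorm_ge0 (grad (fun v => L x v m) 0); split; lra.
exists (C0^-1 / 4), (C2 + C0 * q ^+ 2 + q + C0 + 2 * d%:R * (C1 + C2)).
have dC : 0 <= d%:R * (C1 + C2) by rewrite mulr_ge0// addr_ge0.
have C0q : 0 <= C0 * q ^+ 2 by rewrite mulr_ge0 ?sqr_ge0// ltW.
split; [by rewrite divr_gt0// invr_gt0|lra|move=> m m1].
have coer x u : C0^-1 / 4 * enorm u ^+ 2 -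
    (C2 + C0 * q ^+ 2 + q + C0 + 2 * d%:R * (C1 + C2)) <= L x u m.
  have [Lx _ gLx] := L0' x m m1.
  have := C2_coercive (f := fun x u => L x u m) (LC2 m m1) (fun v => (Luu x v m m1).1) u.
  move: Lx; rewrite ler_norml => /andP[Lx _].
  set e := enorm u; have e0 : 0 <= e by exact: enorm_ge0.
  have ge : k%:R * enorm (grad (fun v => L x v m) 0) * e <= q * e.
    by rewrite ler_wpM2r// ler_wpM2l.
  have : 0 <= C0^-1 * (e - 2 * C0 * q) ^+ 2 by rewrite mulr_ge0 ?sqr_ge0// invr_ge0 ltW.
  have -> : C0^-1 * (e - 2 * C0 * q) ^+ 2 =
     C0^-1 * e ^+ 2 - 4 * (q * e) + 4 * (C0 * q ^+ 2) by field; exact: lt0r_neq0.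
  move: ge; set X := q * e; set Y := C0^-1 * e ^+ 2.
  rewrite (_ : C0^-1 * e ^+ 2 / 2 = Y / 2)// (_ : C0^-1 / 4 * e ^+ 2 = Y / 4).
    by lra.
  by rewrite /Y; field; exact: lt0r_neq0.
split=> //.
- move=> x u; rewrite ler_norml; apply/andP; split.
    apply: le_trans (coer x u); set e := enorm u.
    have : 0 <= (C2 + C0 * q ^+ 2 + q + C0 + 2 * d%:R * (C1 + C2)) * e ^+ 2.
      by rewrite mulr_ge0 ?sqr_ge0//; lra.
    have : 0 <= C0^-1 / 4 * e ^+ 2.
      by rewrite mulr_ge0 ?sqr_ge0// divr_ge0// invr_ge0 ltW.
    by lra.
  have [Lx _ gLx] := L0' x m m1.
  have := C2_growth (f := fun x u => L x u m) (LC2 m m1) (fun v => (Luu x v m m1).2) u.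
  move: Lx; rewrite ler_norml => /andP[_ Lx].
  set e := enorm u; have e0 : 0 <= e by exact: enorm_ge0.
  have ge : k%:R * enorm (grad (fun v => L x v m) 0) * e <= q * e.
    by rewrite ler_wpM2r// ler_wpM2l.
  have qe : q * e <= q * (1 + e ^+ 2).
    by rewrite ler_wpM2l//; have := sqr_ge0 (e - 1); rewrite sqrrB1; nra.
  have : 0 <= (C2 + C0 * q ^+ 2 + C0 + 2 * d%:R * (C1 + C2)) * e ^+ 2.
    by rewrite mulr_ge0 ?sqr_ge0//; lra.
  have : 0 <= C0 * e ^+ 2 by rewrite mulr_ge0 ?sqr_ge0// ltW.
  by nra.
move=> x y u; set e := enorm u; have e0 : 0 <= e by exact: enorm_ge0.
have H : `|L x u m - L y u m - (L x 0 m - L y 0 m)| <=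
    d%:R * `|x - y| * (C1 * (1 + e) * enorm u).
  apply: (C2_mixed_lipschitz (f := fun x u => L x u m) (LC2 m m1)) => z v ve.
  apply: (le_trans (Lxu z v m m1)).
  by rewrite ler_wpM2l// lerD2l.
have H2 : `|L x 0 m - L y 0 m| <= d%:R * C2 * `|x - y|.
  apply: (grad_bound_lipschitz (f := fun z => L z 0 m)) => z.
    apply: (differentiable_uncurry_l (f := fun z v => L z v m)).
    by case: (LC2 m m1) => -[].
  by have [] := L0' z m m1.
rewrite -(subrK (L x 0 m - L y 0 m) (L x u m - L y u m)).
rewrite (le_trans (ler_normD _ _))// (le_trans (lerD H H2))//.
rewrite -/e.
rewrite (_ : d%:R * `|x - y| * _ = d%:R * (C1 * ((1 + e) * e)) * `|x - y|); last by ring.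
rewrite -mulrDl ler_wpM2r//.
have ee : (1 + e) * e <= 2 * (1 + e ^+ 2).
  by have := sqr_ge0 (e - 1); rewrite sqrrB1; nra.
have H3 : d%:R * (C1 * ((1 + e) * e)) <= d%:R * (C1 * (2 * (1 + e ^+ 2))).
  by rewrite ler_wpM2l// ler_wpM2l.
apply: (le_trans (lerD H3 (lexx _))).
have : 0 <= (C2 + C0 * q ^+ 2 + q + C0) * (1 + e ^+ 2).
  by rewrite mulr_ge0 ?addr_ge0 ?sqr_ge0//; lra.
have : 0 <= d%:R * C2 by rewrite mulr_ge0.
have : 0 <= d%:R * C2 * e ^+ 2 by rewrite mulr_ge0 ?sqr_ge0// mulr_ge0.
by lra.
Qed.

(** * Fundamental matrix of a linear system *)

Section fundamental_matrix.
Context {R : realType}.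

Lemma is_cvg_pseries_factorial (c : R^nat) (M K : R) (x : R) : 0 <= M -> 0 <= K ->
  (forall n, `|c n| <= M * (K ^+ n / n`!%:R)) -> cvgn (pseries c x).
Proof.
move=> M0 K0 cK; apply: normed_cvg.
apply: (@series_le_cvg _ _ (fun n => M * exp_coeff (K * `|x|) n)) => [n|n|n|].
- by rewrite normr_ge0.
- by rewrite mulr_ge0// /exp_coeff/= divr_ge0// exprn_ge0// mulr_ge0.
- rewrite /exp_coeff/= normrM normrX exprMn mulrAC mulrA.
  by rewrite ler_wpM2r ?exprn_ge0// -mulrA cK.
- exact/is_cvg_seriesZ/is_cvg_series_exp_coeff.
Qed.

Lemma limn_pseries0 (c : R^nat) : limn (pseries c 0) = c 0%N.
Proof.
apply: lim_near_cst => //; near=> m; rewrite -[m]prednK; last by near: m.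
rewrite /pseries seriesEnat /= big_nat_recl// expr0 mulr1 big1 ?addr0// => i _.
by rewrite expr0n mulr0.
Unshelve. all: by end_near. Qed.

Context {d : nat} (A : 'M[R]_d).

Let expcoef (i j : 'I_d) (n : nat) : R := (A ^+ n) i j / n`!%:R.
Let K : R := 1 + \sum_i \sum_j `|A i j|.
Let K0 : 0 <= K.
Proof. by rewrite addr_ge0// sumr_ge0// => i _; rewrite sumr_ge0. Qed.

Let exprK n i j : `|(A ^+ n) i j| <= K ^+ n.
Proof.
elim: n i j => [|n IH] i j.
  by rewrite !expr0 mxE; case: eqP; rewrite ?normr1 ?normr0.
rewrite exprS mxE (le_trans (ler_norm_sum _ _ _))// exprS mulrDl mul1r.
apply: (@le_trans _ _ ((\sum_l `|A i l|) * K ^+ n)).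
  rewrite mulr_suml ler_sum// => l _; rewrite normrM ler_wpM2l//.
rewrite -[leLHS]add0r lerD ?exprn_ge0// ler_wpM2r ?exprn_ge0//.
by rewrite [leRHS](bigD1 i)//= lerDl sumr_ge0// => l _; rewrite sumr_ge0.
Qed.

Let diffs_expcoef i j n :
  pseries_diffs (expcoef i j) n = (A ^+ n.+1) i j / n`!%:R.
Proof.
have n0 : n.+1%:R != 0 :> R by rewrite pnatr_eq0.
rewrite /pseries_diffs /expcoef factS natrM invfM.
rewrite [X in _ * X]mulrCA mulVKf//.
Qed.

Let cvg_expcoef i j s : cvgn (pseries (expcoef i j) s).
Proof.
apply: (@is_cvg_pseries_factorial _ 1 K) => // n.
by rewrite mul1r normrM normfV normr_nat ler_wpM2r// exprK.
Qed.

Lemma fundamental_matrix : exists Z : R -> 'M[R]_d, Z 0 = 1%:M /\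
  forall (s : R) i j, is_derive s (1 : R) (fun t => Z t i j) ((A *m Z s) i j).
Proof.
exists (fun s => \matrix_(i, j) limn (pseries (expcoef i j) s)); split.
  apply/matrixP => i j; rewrite mxE limn_pseries0 /expcoef expr0 fact0 divr1.
  by rewrite mxE.
move=> s i j.
rewrite (_ : (fun t => _) = fun t => limn (pseries (expcoef i j) t)); last first.
  by apply/funext => t; rewrite mxE.
have cvg1 t : cvgn (pseries (pseries_diffs (expcoef i j)) t).
  apply: (@is_cvg_pseries_factorial _ K K) => // n.
  rewrite diffs_expcoef normrM normfV normr_nat mulrA -exprS ler_wpM2r//.
have cvg2 t : cvgn (pseries (pseries_diffs (pseries_diffs (expcoef i j))) t).
  apply: (@is_cvg_pseries_factorial _ (K ^+ 2) K) => [||n]; rewrite ?exprn_ge0//.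
  have n0 : n.+1%:R != 0 :> R by rewrite pnatr_eq0.
  rewrite {1}/pseries_diffs diffs_expcoef factS natrM invfM.
  rewrite [X in `|X|]mulrCA mulVKf//.
  rewrite mulrA.
  rewrite normrM normfV normr_nat -exprD ler_wpM2r//.
have := @pseries_snd_diffs R (expcoef i j) (`|s| + 1) s (@cvg_expcoef i j _)
  (cvg1 _) (cvg2 _).
rewrite [ltRHS]ger0_norm ?addr_ge0// ltrDl ltr01 => /(_ isT) H.
apply: (is_derive_eq H).
rewrite mxE.
apply: cvg_lim => //.
have -> : pseries (pseries_diffs (expcoef i j)) s =
    fun n => \sum_l A i l * pseries (expcoef l j) s n.
  apply/funext => n; rewrite /pseries !seriesEnat/=.
  under [RHS]eq_bigr do rewrite mulr_sumr.
  rewrite exchange_big/=; apply: eq_bigr => m _.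
  rewrite diffs_expcoef exprS mxE !mulr_suml; apply: eq_bigr => l _.
  by rewrite /expcoef !mulrA.
apply: cvg_big => [|l _]; first exact: add_continuous.
rewrite mxE; apply: cvgMr; exact: cvg_expcoef.
Qed.

End fundamental_matrix.

(** * Curves and their marginals *)

Section borel_measurability.
Context {R : realType}.

Lemma continuous_borel_measurable (E : ptopologicalType) (f : E -> R) :
  continuous f -> measurable_fun setT (f : borel E -> R).
Proof.
move=> /continuousP cf; apply: (measurability _ (RGenOpens.measurableE R)).
move=> _ [_ [a [b ->] <-]]; rewrite setTI; apply: sub_sigma_algebra.
exact/cf/interval_open.
Qed.

Lemma borel_coord_measurable n (i : 'I_n) :
  measurable_fun setT ((fun x : 'cV[R]_n => x i 0) : borel 'cV[R]_n -> R).
Proof. by apply: continuous_borel_measurable; exact: coord_continuous. Qed.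

Lemma sqrt_measurable : measurable_fun [set: R] Num.sqrt.
Proof. by apply: continuous_measurable_fun; exact: sqrt_continuous. Qed.

Lemma measurable_fun_enorm d (T : measurableType d) (D : set T) n
    (f : T -> 'cV[R]_n) :
  (forall i, measurable_fun D (fun x => f x i 0)) ->
  measurable_fun D (fun x => enorm (f x)).
Proof.
move=> mf; apply: (measurableT_comp sqrt_measurable).
by apply: measurable_sum => i; exact: measurable_funX.
Qed.

Lemma borel_enorm_measurable n :
  measurable_fun setT (@enorm R n : borel 'cV[R]_n -> R).
Proof.
by apply: measurable_fun_enorm => i; exact: borel_coord_measurable.
Qed.

End borel_measurability.

Section dynamics.
Context {R : realType} {d k : nat} (A : 'M[R]_d) (B : 'M[R]_(d, k)).
Notation mu := (@lebesgue_measure R).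

Lemma in_L1P (a b : R) (u : R -> 'cV[R]_k) : in_Lp 1 a b u ->
  measurable_fun `[a, b] (u : R -> borel 'cV[R]_k) /\
  mu.-integrable `[a, b] (fun s => (enorm (u s))%:E).
Proof.
case=> mu_ iu; split => //; apply/integrableP; split.
  by apply/measurable_EFinP; apply: (measurableT_comp (@borel_enorm_measurable R k)).
apply: le_lt_trans iu; rewrite le_eqVlt; apply/orP; left; apply/eqP.
apply: eq_integral => s _.
by rewrite powRr1 ?enorm_ge0//= ger0_norm ?enorm_ge0.
Qed.

Lemma in_L2P (a b : R) (u : R -> 'cV[R]_k) : in_Lp 2 a b u <->
  measurable_fun `[a, b] (u : R -> borel 'cV[R]_k) /\
  mu.-integrable `[a, b] (fun s => (enorm (u s) ^+ 2)%:E).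
Proof.
have E1 : (\int[mu]_(s in `[a, b]) (enorm (u s) `^ 2)%:E
    = \int[mu]_(s in `[a, b]) `|(enorm (u s) ^+ 2)%:E|)%E.
  apply: eq_integral => s _; rewrite powR_mulrn ?enorm_ge0//=.
  by rewrite ger0_norm// sqr_ge0.
split=> -[mu_ iu]; split => //.
  apply/integrableP; split; last by rewrite -E1.
  apply/measurable_EFinP; apply: measurable_funX.
  by apply: (measurableT_comp (@borel_enorm_measurable R k)).
by rewrite E1; case/integrableP : iu.
Qed.

Lemma integrable_itv_cst (a b c : R) : mu.-integrable `[a, b] (EFin \o cst c).
Proof.
apply: continuous_compact_integrable; first exact: segment_compact.
by apply: continuous_subspaceT => x; exact: cvg_cst.
Qed.

Lemma in_L2_L1 (a b : R) (u : R -> 'cV[R]_k) : in_Lp 2 a b u -> in_Lp 1 a b u.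
Proof.
move=> /in_L2P[mu_ iu]; split=> //.
have : mu.-integrable `[a, b] (fun s => (1 + enorm (u s) ^+ 2)%:E).
  exact: integrableD (integrable_itv_cst a b 1) iu.
case/integrableP => m1; apply: le_lt_trans; apply: ge0_le_integral => //=.
- by move=> s _; rewrite lee_fin powR_ge0.
- apply/measurable_EFinP; apply: (measurableT_comp (measurable_powR 1)).
  by apply: (measurableT_comp (@borel_enorm_measurable R k)).
- apply/measurable_EFinP; apply: measurableT_comp => //.
  exact/measurable_EFinP.
move=> s _; rewrite lee_fin powRr1 ?enorm_ge0//.
rewrite ger0_norm ?addr_ge0 ?sqr_ge0//.
by have := sqr_ge0 (enorm (u s) - 1); rewrite sqrrB1; have := enorm_ge0 (u s); nra.
Qed.

Lemma within_continuous_coord n (D : set R) (g : R -> 'cV[R]_n) i :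
  {within D, continuous g} -> {within D, continuous (fun s => g s i 0)}.
Proof.
move=> cg x; apply: (@continuous_comp _ _ _ (g : subspace D -> _) (fun M => M i 0)).
  exact: cg.
exact: coord_continuous.
Qed.

Lemma integrable_dynamics (a b : R) (u : R -> 'cV[R]_k) (g : R -> 'cV[R]_d) i :
  in_Lp 1 a b u -> {within `[a, b], continuous g} ->
  mu.-integrable `[a, b] (EFin \o (fun r => (A *m g r + B *m u r) i 0)).
Proof.
move=> /in_L1P[mu_ iu] cg.
have ig j : mu.-integrable `[a, b] (EFin \o (fun r => g r j 0)).
  apply: continuous_compact_integrable; first exact: segment_compact.
  exact: within_continuous_coord.
have iuj j : mu.-integrable `[a, b] (EFin \o (fun r => u r j 0)).
  apply: le_integrable iu => //.
    apply/measurable_EFinP.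
    by apply: (measurableT_comp (@borel_coord_measurable R k j)).
  by move=> s _ /=; rewrite lee_fin [leRHS]ger0_norm ?enorm_ge0// coord_le_enorm.
rewrite (_ : _ \o _ = fun r => ((\sum_j (A i j * g r j 0)%:E) +
    (\sum_j (B i j * u r j 0)%:E))%E); last first.
  by apply/funext => r /=; rewrite !mxE EFinD !sumEFin.
apply: integrableD => //.
  by apply: integrable_sum => // j _; exact: integrableZl (ig j).
by apply: integrable_sum => // j _; exact: integrableZl (iuj j).
Qed.

Lemma integrable_itvS (a b s t : R) (f : R -> R) : a <= s -> t <= b ->
  mu.-integrable `[a, b] (EFin \o f) -> mu.-integrable `[s, t] (EFin \o f).
Proof.
move=> as_ tb; apply: integrableS => //.
by apply: subset_itvScc; rewrite bnd_simp.
Qed.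

Lemma Rintegral_itv_split (a b s : R) (f : R -> R) : a <= s -> s <= b ->
  mu.-integrable `[a, b] (EFin \o f) ->
  \int[mu]_(r in `[a, b]) f r =
    \int[mu]_(r in `[a, s]) f r + \int[mu]_(r in `[s, b]) f r.
Proof.
move=> as_ sb fi; have := @Rintegral_itvB R f (BLeft a) (BRight b) s fi.
rewrite !bnd_simp => /(_ as_ sb) /eqP; rewrite subr_eq addrC => /eqP ->.
congr (_ + _); apply: Rintegral_itv_obnd_cbnd.
apply: (integrableS _ _ _ fi) => //; apply: subset_itv; by rewrite bnd_simp.
Qed.

Lemma trajectory_increment (a b : R) (x0 : 'cV[R]_d) (u : R -> 'cV[R]_k)
    (g : R -> 'cV[R]_d) (s t : R) i :
  in_Lp 1 a b u -> trajectory A B a b x0 u g -> a <= s -> s <= t -> t <= b ->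
  g t i 0 - g s i 0 = \int[mu]_(r in `[s, t]) (A *m g r + B *m u r) i 0.
Proof.
move=> iu [cg gE] as_ st tb.
have fi := integrable_dynamics i iu cg.
rewrite gE ?in_itv/= ?(le_trans as_ st) ?tb// [g s i 0]gE; last first.
  by rewrite in_itv/= as_ (le_trans st tb).
rewrite (Rintegral_itv_split as_ st); last exact: integrable_itvS fi.
by rewrite [X in X + _]addrC; ring.
Qed.

End dynamics.

(* [f2] need not be measurable (the integral of a nonnegative function is a
   supremum over simple functions below it); it will be [derive1 g] or [speed2]. *)
Lemma le_integral_lower d (T : measurableType d) (R : realType)
    (mu : {measure set T -> \bar R}) (D1 D2 : set T) (f1 f2 : T -> \bar R) :
  D1 `<=` D2 -> (forall x, D1 x -> 0 <= f1 x)%E ->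
  (forall x, D2 x -> 0 <= f2 x)%E -> (forall x, D1 x -> f1 x <= f2 x)%E ->
  (\int[mu]_(x in D1) f1 x <= \int[mu]_(x in D2) f2 x)%E.
Proof.
move=> D12 f10 f20 f12; rewrite !ge0_integralE//.
apply: le_ereal_sup => _ [h hf1 <-]; exists h => // x.
apply: (le_trans (hf1 x)); rewrite !patchE; case: ifPn => [/set_mem D1x|_].
  by rewrite mem_set ?f12//; exact: D12.
by case: ifPn => // /set_mem; exact: f20.
Qed.

Section curve_speed.
Context {R : realType} {d k : nat} (A : 'M[R]_d) (B : 'M[R]_(d, k)).
Notation mu := (@lebesgue_measure R).

Lemma trajectory_derive_ae (a b : R) (x0 : 'cV[R]_d) (u : R -> 'cV[R]_k)
    (g : R -> 'cV[R]_d) :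
  in_Lp 1 a b u -> trajectory A B a b x0 u g ->
  {ae mu, forall t, t \in `]a, b[ -> derive1 g t = A *m g t + B *m u t}.
Proof.
move=> iu tg; have [cg gE] := tg.
have aef := ae_filter_ringOfSetsType mu.
pose f i (r : R) : R := (A *m g r + B *m u r) i 0.
have fi i : mu.-integrable `[a, b] (EFin \o f i) := integrable_dynamics A B i iu cg.
have : {ae mu, forall t, forall i, lebesgue_pt (f i \_ `[a, b]) t}.
  apply: filter_forall => i; apply: lebesgue_differentiation.
  exact: integrable_locally.
apply: filterS => t lt; rewrite in_itv/= => /andP[at_ tb].
have deri i : is_derive t (1 : R) (fun y => g y i 0) (f i t).
  have fi' : mu.-integrable `[a, b] (EFin \o (f i \_ `[a, b])).
    by rewrite -restrict_EFin; apply/integrable_restrict => //=; rewrite setIid.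
  have [] := @FTC1_lebesgue_pt R (f i \_ `[a, b]) (BLeft a) t b tb fi' _ (lt i).
    by rewrite /= lte_fin.
  set F := (X in derivable X _ _) => dF F'.
  have F'E : 'D_1 F t = f i t.
    by rewrite -derive1E F' patchE mem_set//= in_itv/= !ltW.
  apply: (@near_eq_is_derive _ _ _ (fun y => x0 i 0 + F y)); last first.
    have dF' : is_derive t (1 : R) F (f i t) by split.
    rewrite -[f i t]add0r; exact: (is_deriveD (is_derive_cst (x0 i 0) t 1) dF').
  have : \forall y \near t, y \in `]a, b[.
    by apply: near_in_itvoo; rewrite in_itv/= at_.
  apply: filterS => y; rewrite in_itv/= => /andP[ay yb].
  rewrite gE ?in_itv/= ?(ltW ay) ?ltW//; congr (_ + _).
  apply: eq_Rintegral => r; rewrite inE/= in_itv/= => /andP[ar ry].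
  by rewrite patchE mem_set//= in_itv/= ar (le_trans ry) ?ltW.
have dg : derivable g t 1.
  by apply/derivable_mxP => i j; rewrite (ord1 j); case: (deri i).
rewrite derive1E derive_mx//; apply/matrixP => i j.
by rewrite (ord1 j) [LHS]mxE; case: (deri i).
Qed.

(* Cauchy-Schwarz through [2 l f - l^2 <= f^2], where [l] is the mean of [f] on [[s, t]]. *)
Lemma trajectory_increment_sqr (a b : R) (x0 : 'cV[R]_d) (u : R -> 'cV[R]_k)
    (g : R -> 'cV[R]_d) (s t : R) i :
  in_Lp 1 a b u -> trajectory A B a b x0 u g -> a <= s -> s < t -> t <= b ->
  (((g t i 0 - g s i 0) ^+ 2 / (t - s))%:E <=
   \int[mu]_(r in `[a, b]) (enorm (derive1 g r) ^+ 2)%:E)%E.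
Proof.
move=> iu tg as_ st tb; have [cg gE] := tg.
pose f (r : R) : R := (A *m g r + B *m u r) i 0.
have fi : mu.-integrable `[s, t] (EFin \o f).
  exact: integrable_itvS (integrable_dynamics A B i iu cg).
have h0 : 0 < t - s by rewrite subr_gt0.
have -> := trajectory_increment i iu tg as_ (ltW st) tb.
set I := \int[mu]_(r in `[s, t]) f r.
have [N [mN N0 Nsub]] := trajectory_derive_ae iu tg.
have mf : measurable_fun `[s, t] f.
  by apply/measurable_EFinP; case/integrableP: fi.
have D1 : `]s, t[ `<=` (`[s, t] : set R) by apply: subset_itv; rewrite bnd_simp.
have mf2 : measurable_fun `]s, t[ (fun r => (f r ^+ 2)%:E).
  apply/measurable_EFinP; apply: measurable_funX.
  exact: measurable_funS mf.
have le1 : (\int[mu]_(r in `[s, t]) (f r ^+ 2)%:E <=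
    \int[mu]_(r in `[a, b]) (enorm (derive1 g r) ^+ 2)%:E)%E.
  rewrite integral_itv_bndoo// (@ge0_negligible_integral _ _ _ mu _ N)//; last first.
    by move=> r _; rewrite lee_fin sqr_ge0.
  apply: le_integral_lower.
  - move=> r [/= + _]; rewrite !in_itv/= => /andP[sr rt].
    by rewrite (le_trans as_ (ltW sr)) (le_trans (ltW rt)).
  - by move=> r _; rewrite lee_fin sqr_ge0.
  - by move=> r _; rewrite lee_fin sqr_ge0.
  move=> r [/= + Nr]; rewrite in_itv/= => /andP[sr rt].
  have -> : derive1 g r = A *m g r + B *m u r.
    apply: contrapT => H; apply: Nr; apply: Nsub => /= /(_ _)/H; apply.
    by rewrite in_itv/= (le_lt_trans as_) ?(lt_le_trans rt).
  rewrite lee_fin -ler_sqrt ?sqr_ge0// !sqrtr_sqr (ger0_norm (enorm_ge0 _)).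
  exact: coord_le_enorm.
apply: le_trans le1.
have cst_int (c : R) : (\int[mu]_(r in `[s, t]) c%:E = (c * (t - s))%:E)%E.
  by rewrite integral_cst//= lebesgue_measure_itv/= lte_fin st EFinM EFinB.
pose l := I / (t - s).
have : (\int[mu]_(r in `[s, t]) ((2 * l) * f r - l ^+ 2)%:E <=
    \int[mu]_(r in `[s, t]) (f r ^+ 2)%:E)%E.
  have [/eqP -> |fin] := boolP (\int[mu]_(r in `[s, t]) (f r ^+ 2)%:E == +oo)%E.
    exact: leey.
  have lf : mu.-integrable `[s, t] (fun r => (2 * l * f r)%:E).
    exact: (integrableZl _ (2 * l) fi).
  apply: le_integral => //=.
  - exact: integrableB lf (integrable_itv_cst s t (l ^+ 2)).
  - apply/integrableP; split.
      by apply/measurable_EFinP; exact: measurable_funX.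
    have -> : (\int[mu]_(r in `[s, t]) `|(f r ^+ 2)%:E| =
        \int[mu]_(r in `[s, t]) (f r ^+ 2)%:E)%E.
      by apply: eq_integral => r _; rewrite /= ger0_norm ?sqr_ge0.
    by rewrite lt_neqAle fin leey.
  by move=> r _; rewrite lee_fin; have := sqr_ge0 (f r - l); nra.
apply: le_trans.
have -> : (\int[mu]_(r in `[s, t]) (2 * l * f r - l ^+ 2)%:E =
  (2 * l * I - l ^+ 2 * (t - s))%:E)%E.
  under eq_integral do rewrite EFinB EFinM.
  rewrite integralB//; last 2 first.
  - exact: integrableZl.
  - exact: (integrable_itv_cst s t (l ^+ 2)).
  have IE : (\int[mu]_(r in `[s, t]) (f r)%:E = I%:E)%E.
    by rewrite /I /Rintegral fineK//; exact: integrable_fin_num.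
  by rewrite cst_int integralZl// IE.
by rewrite lee_fin le_eqVlt; apply/orP; left; apply/eqP; rewrite /l; field; exact: lt0r_neq0.
Qed.

Context {T : {posnum R}}.

Lemma curve_increment_speed2 (g : curve A B T) (s t : R) i :
  0 <= s -> s <= t -> t <= T%:num ->
  (`|curve_fun g t i 0 - curve_fun g s i 0|%:E <=
   (Num.sqrt (t - s))%:E * speed2 g)%E.
Proof.
move=> s0; rewrite le_eqVlt => /predU1P[<- _|st tT].
  by rewrite !subrr normr0 sqrtr0 mul0e.
have /set_mem[[x [u [iu tg]]] _] := valP g.
have := trajectory_increment_sqr i iu tg s0 st tT.
rewrite /speed2 -/(curve_fun g); set J := (\int[_]_(_ in _) _)%E.
set D := curve_fun g t i 0 - curve_fun g s i 0.
have h0 : 0 < t - s by rewrite subr_gt0.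
have J0 : (0 <= J)%E by apply: integral_ge0 => r _; rewrite lee_fin sqr_ge0.
rewrite poweR12_sqrt//.
case: J J0 => [J J0|_ _|//]; last by rewrite /= mulry gtr0_sg ?sqrtr_gt0// mul1e leey.
rewrite /= -EFinM !lee_fin ler_pdivrMr// => H.
rewrite -sqrtrM ?(ltW h0)// -sqrtr_sqr ler_sqrt; first by rewrite mulrC.
by rewrite mulr_ge0// ltW.
Qed.

End curve_speed.

Lemma le_add1_powR (R : realType) (w a : R) : 0 <= w -> 1 < a -> w <= 1 + w `^ a.
Proof.
move=> w0 a1; have [w1|w1] := leP w 1.
  by rewrite (le_trans w1)// lerDl powR_ge0.
rewrite -[leLHS]powRr1// (@le_trans _ _ (w `^ a))//; last by rewrite lerDr.
by rewrite ler_powR// ltW.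
Qed.

Section flow_regularity.
Context {R : realType} {d k : nat} {A : 'M[R]_d} {B : 'M[R]_(d, k)}.
Context {T : {posnum R}}.
Variable eta : probability (borel (curve A B T)) R.

Let measurable_curve_coord (t : R) i :
  measurable_fun setT
    ((fun g : curve A B T => curve_fun g t i 0) : borel (curve A B T) -> R).
Proof.
exact: (measurableT_comp (@borel_coord_measurable R d i) (@measurable_e_ _ _ _ A B T t)).
Qed.

Lemma ge0_integral_flow (t : R) (f : borel 'cV[R]_d -> \bar R) :
  measurable_fun setT f -> (forall x, 0 <= f x)%E ->
  (\int[flow eta t]_x f x = \int[eta]_g f (curve_fun g t))%E.
Proof. by move=> mf f0; rewrite ge0_integral_distribution. Qed.

Lemma dist1_flow_le (s t : R) :
  (dist1 (flow eta s) (flow eta t) <=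
   \int[eta]_g (enorm (curve_fun g s - curve_fun g t))%:E)%E.
Proof.
have mst : measurable_fun setT
    (fun g : borel (curve A B T) => (e_ s g, e_ t g)).
  by apply: measurable_fun_pair; exact: measurable_e_.
pose X : {mfun borel (curve A B T) >-> (borel 'cV[R]_d * borel 'cV[R]_d)%type} :=
  mfun_Sub (mem_set mst).
apply: ereal_inf_lbound; exists (distribution eta X) => /=.
  by split => S mS.
rewrite ge0_integral_distribution//.
- apply/measurable_EFinP; apply: measurable_fun_enorm => i.
  rewrite (_ : (fun z => _) =
      fun z : borel 'cV[R]_d * borel 'cV[R]_d => z.1 i 0 - z.2 i 0); last first.
    by apply/funext => z; rewrite !mxE.
  apply: measurable_funB.
    by apply: (measurableT_comp (@borel_coord_measurable R d i)).
  by apply: (measurableT_comp (@borel_coord_measurable R d i)).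
- by move=> z; rewrite lee_fin enorm_ge0.
Qed.

Context {alpha r : R} {m0 : probability (borel 'cV[R]_d) R}.
Hypothesis alpha1 : 1 < alpha.
Hypothesis eta_P : P_m0 alpha m0 r eta.

Lemma integral_curve_increment (s t : R) i : 0 <= s -> s <= t -> t <= T%:num ->
  (\int[eta]_g `|curve_fun g t i 0 - curve_fun g s i 0|%:E <=
    (Num.sqrt (t - s) * (1 + r))%:E)%E.
Proof.
move=> s0; rewrite le_eqVlt => /predU1P[<- _|st tT].
  rewrite subrr sqrtr0 mul0r integral0_eq// => g _.
  by rewrite subrr normr0.
set h := Num.sqrt (t - s); have h0 : 0 < h by rewrite sqrtr_gt0 subr_gt0.
pose w (g : curve A B T) : R := `|curve_fun g t i 0 - curve_fun g s i 0| / h.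
have w0 g : 0 <= w g by rewrite divr_ge0// ltW.
have mw : measurable_fun setT (w : borel (curve A B T) -> R).
  apply: measurable_funM => //; apply: measurableT_comp => //.
  by apply: measurable_funB; exact: measurable_curve_coord.
have mwa : measurable_fun setT ((fun g => w g `^ alpha) : borel (curve A B T) -> R).
  exact: (measurableT_comp (measurable_powR alpha) mw).
have wr : (\int[eta]_g (w g `^ alpha)%:E <= r%:E)%E.
  have [+ _] := eta_P; apply: le_trans; apply: le_integral_lower => // g _.
  - by rewrite lee_fin powR_ge0.
  - by rewrite poweR_ge0.
  rewrite -poweR_EFin gt0_ler_poweR ?in_itv/= ?(ltW (lt_trans ltr01 alpha1))//.
  - by rewrite lee_fin w0 leey.
  - by rewrite poweR_ge0 leey.
  have := curve_increment_speed2 g i s0 (ltW st) tT; rewrite -/h => H.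
  by rewrite /w mulrC EFinM lee_pdivrMl.
apply: (@le_trans _ _ (\int[eta]_g (h%:E * (1 + w g `^ alpha)%:E))%E).
  apply: ge0_le_integral => //.
  - apply/measurable_EFinP; apply: measurableT_comp => //.
    by apply: measurable_funB; exact: measurable_curve_coord.
  - apply/measurable_EFinP; apply: measurable_funM => //.
    exact: measurable_funD.
  move=> g _; rewrite -EFinM lee_fin.
  rewrite -[leLHS](@divfK _ h) ?gt_eqF// mulrC ler_pM2l//.
  exact: (le_add1_powR (w0 g) alpha1).
have m1w : measurable_fun setT ((fun g => (1 + w g `^ alpha)%:E) : borel (curve A B T) -> \bar R).
  by apply/measurable_EFinP; exact: measurable_funD.
rewrite ge0_integralZl_EFin ?(ltW h0)//; last first.
  by move=> g _; rewrite lee_fin addr_ge0 ?powR_ge0.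
rewrite EFinM lee_pmul2l ?lte_fin//.
under eq_integral do rewrite EFinD.
rewrite ge0_integralD//=; last 2 first.
- by move=> g _; rewrite lee_fin powR_ge0.
- exact/measurable_EFinP.
rewrite integral_cst// mul1e EFinD.
by rewrite leeD//; exact: (probability_le1 eta measurableT).
Qed.

Lemma dist1_flow_hoelder : exists2 C : R, 0 <= C & forall s t : R,
  0 <= s <= T%:num -> 0 <= t <= T%:num ->
  (dist1 (flow eta s) (flow eta t) <= (C * Num.sqrt `|s - t|)%:E)%E.
Proof.
have r0 : 0 <= r.
  have [+ _] := eta_P; rewrite -lee_fin; apply: le_trans.
  by apply: integral_ge0 => g _; exact: poweR_ge0.
exists (d%:R * (1 + r)) => [|s t]; first by rewrite mulr_ge0// addr_ge0.
move=> /andP[s0 sT] /andP[t0 tT]; apply: (le_trans (dist1_flow_le s t)).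
have E1 i : (\int[eta]_g `|curve_fun g s i 0 - curve_fun g t i 0|%:E <=
    (Num.sqrt `|s - t| * (1 + r))%:E)%E.
  have [st|ts] := leP s t.
    rewrite distrC ger0_norm ?subr_ge0//.
    apply: le_trans (integral_curve_increment i s0 st tT).
    by under eq_integral do rewrite distrC.
  rewrite ger0_norm ?subr_ge0 ?(ltW ts)//.
  exact: integral_curve_increment i t0 (ltW ts) sT.
have mi i : measurable_fun setT ((fun g : curve A B T =>
    `|curve_fun g s i 0 - curve_fun g t i 0|%:E) : borel (curve A B T) -> \bar R).
  apply/measurable_EFinP; apply: measurableT_comp => //.
  by apply: measurable_funB; exact: measurable_curve_coord.
apply: (@le_trans _ _ (\int[eta]_g
    \sum_i `|curve_fun g s i 0 - curve_fun g t i 0|%:E)%E).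
  apply: ge0_le_integral => //.
  - by move=> g _; rewrite lee_fin enorm_ge0.
  - apply/measurable_EFinP; apply: measurable_fun_enorm => i.
    rewrite (_ : (fun z => _) = fun z => curve_fun z s i 0 - curve_fun z t i 0); last first.
      by apply/funext => z; rewrite !mxE.
    by apply: measurable_funB; exact: measurable_curve_coord.
  - by apply: emeasurable_sum => i.
  move=> g _; rewrite sumEFin lee_fin (le_trans (enorm_le_sum _))// ler_sum// => i _.
  by rewrite !mxE.
rewrite ge0_integral_sum//.
apply: (le_trans (lee_sum _ (fun i _ => E1 i))).
rewrite sumEFin lee_fin sumr_const card_ord.
by rewrite le_eqVlt; apply/orP; left; apply/eqP; ring.
Qed.

Hypothesis m0_P : in_Pp alpha m0.

Lemma flow_P1 (t : R) : 0 <= t <= T%:num -> in_Pp 1 (flow eta t).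
Proof.
move=> /andP[t0 tT]; rewrite /in_Pp /moment ge0_integral_flow; last 2 first.
- apply/measurable_EFinP.
  exact: (measurableT_comp (measurable_powR 1) (@borel_enorm_measurable R d)).
- by move=> x; rewrite lee_fin powR_ge0.
have m0P : (\int[eta]_g (enorm (curve_fun g 0))%:E < +oo)%E.
  rewrite -(@ge0_integral_flow 0 (fun x => (enorm x)%:E)); last 2 first.
  - by apply/measurable_EFinP; exact: borel_enorm_measurable.
  - by move=> x; rewrite lee_fin enorm_ge0.
  rewrite (eq_measure_integral m0); last by case: eta_P => _ + S mS _; exact.
  have : (\int[m0]_x (1%:E + (enorm x `^ alpha)%:E) < +oo)%E.
    rewrite ge0_integralD//=; last 2 first.
    - by move=> g _; rewrite lee_fin powR_ge0.
    - apply/measurable_EFinP.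
      exact: (measurableT_comp (measurable_powR _) (@borel_enorm_measurable R d)).
    apply: lte_add_pinfty => //; rewrite integral_cst// mul1e.
    exact: (le_lt_trans (probability_le1 m0 measurableT) (ltry 1)).
  apply: le_lt_trans; apply: ge0_le_integral => //.
  - by move=> x _; rewrite lee_fin enorm_ge0.
  - by apply/measurable_EFinP; exact: borel_enorm_measurable.
  - apply/measurable_EFinP; apply: measurable_funD => //.
    exact: (measurableT_comp (measurable_powR _) (@borel_enorm_measurable R d)).
  by move=> x _; rewrite -EFinD lee_fin le_add1_powR ?enorm_ge0.
have mi i : measurable_fun setT ((fun g : curve A B T =>
    `|curve_fun g t i 0 - curve_fun g 0 i 0|%:E) : borel (curve A B T) -> \bar R).
  apply/measurable_EFinP; apply: measurableT_comp => //.
  by apply: measurable_funB; exact: measurable_curve_coord.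
have menorm s : measurable_fun setT ((fun g : curve A B T => enorm (curve_fun g s)) :
    borel (curve A B T) -> R).
  by apply: measurable_fun_enorm => i; exact: measurable_curve_coord.
have finsum : (\int[eta]_g (d%:R%:E * (enorm (curve_fun g 0))%:E +
    \sum_i `|curve_fun g t i 0 - curve_fun g 0 i 0|%:E) < +oo)%E.
  rewrite ge0_integralD//; last 4 first.
  - by move=> g _; rewrite -EFinM lee_fin mulr_ge0 ?enorm_ge0.
  - by apply/measurable_EFinP; apply: measurable_funM.
  - by move=> g _; rewrite sumEFin lee_fin sumr_ge0.
  - by apply: emeasurable_sum => i.
  apply: lte_add_pinfty.
    rewrite ge0_integralZl_EFin ?lte_mul_pinfty//.
    - by move=> g _; rewrite lee_fin enorm_ge0.
    - exact/measurable_EFinP.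
  rewrite ge0_integral_sum// (le_lt_trans (lee_sum _ (fun i _ =>
     integral_curve_increment i (lexx 0) t0 tT)))//.
  by rewrite sumEFin ltry.
apply: le_lt_trans finsum; apply: ge0_le_integral => //.
- by move=> g _; rewrite lee_fin powR_ge0.
- apply/measurable_EFinP; exact: (measurableT_comp (measurable_powR _) (menorm t)).
- apply: emeasurable_funD.
    by apply/measurable_EFinP; apply: measurable_funM.
  by apply: emeasurable_sum => i.
move=> g _; rewrite sumEFin -EFinM -EFinD lee_fin powRr1 ?enorm_ge0//.
rewrite (le_trans (enorm_le_sum _))//.
rewrite (_ : d%:R * _ = \sum_(i < d) enorm (curve_fun g 0)); last first.
  by rewrite sumr_const card_ord mulr_natl.
rewrite -big_split ler_sum//= => i _.
rewrite -[X in `|X|](subrK (curve_fun g 0 i 0)) addrC.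
rewrite (le_trans (ler_normD _ _))//. by apply: lerD => //; exact: coord_le_enorm.
Qed.

End flow_regularity.

(* Measurability comes from freezing the time variable of [h] on a grid of mesh 1/(n+1). *)
Lemma caratheodory_measurable (R : realType) (k : nat) (a b : R)
    (h : R -> 'cV[R]_k -> R) (u : R -> 'cV[R]_k) :
  measurable_fun `[a, b] (u : R -> borel 'cV[R]_k) ->
  (forall s, s \in `[a, b] -> continuous (h s)) ->
  (forall v s, s \in `[a, b] -> forall e, 0 < e -> exists2 r, 0 < r &
    forall s', s' \in `[a, b] -> `|s - s'| < r -> `|h s v - h s' v| < e) ->
  measurable_fun `[a, b] (fun s => h s (u s)).
Proof.
move=> mu_ ch hc.
pose N n s := Num.truncn ((s - a) * n.+1%:R).
pose p n s := a + (N n s)%:R / n.+1%:R.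
have pP n s : s \in `[a, b] -> a <= p n s /\ p n s <= s < p n s + n.+1%:R^-1.
  rewrite in_itv/= => /andP[as_ _].
  have n0 : 0 < n.+1%:R :> R by [].
  have := @truncn_itv R ((s - a) * n.+1%:R).
  rewrite mulr_ge0 ?subr_ge0// => /(_ isT) /andP[].
  rewrite -/(N n s) -ler_pdivrMr// -ltr_pdivlMr// => H1 H2.
  split; first by rewrite lerDl divr_ge0.
  move: H2; rewrite -natr1 mulrDl div1r => H2.
  by rewrite /p -lerBrDl H1/= -addrA -ltrBlDl.
have pab n s : s \in `[a, b] -> p n s \in `[a, b].
  move=> sab; have [ap /andP[ps _]] := pP n s sab.
  by move: sab; rewrite !in_itv/= ap => /andP[_]; exact: le_trans.
apply: (@measurable_fun_cvg _ _ R `[a, b] (fun n s => h (p n s) (u s))).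
  move=> n.
  have n0 : 0 < n.+1%:R :> R by [].
  pose E j : set R := `[a, b] `&` `[a + j%:R / n.+1%:R, a + j.+1%:R / n.+1%:R[.
  have EN j s : E j s -> N n s = j.
    move=> [_ /=]; rewrite in_itv/= => /andP[js sj].
    by apply: truncn_def; rewrite -ler_pdivrMr// -ltr_pdivlMr// lerBrDl ltrBlDl js.
  have -> : `[a, b]%classic = \bigcup_j E j.
    apply/seteqP; split=> [s sab|s [j _ []]//].
    exists (N n s) => //; split => //=; rewrite in_itv/=.
    have [_ /andP[ps sp]] := pP n s sab.
    by rewrite ps/= -natr1 mulrDl div1r addrA.
  apply/measurable_fun_bigcup => j; first exact: measurableI.
  have [E0|/set0P[s0 Es0]] := eqVneq (E j) set0.
    by rewrite E0; exact: measurable_fun_set0.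
  apply: (@eq_measurable_fun _ _ _ _ _ (fun s => h (p n s0) (u s))).
    by move=> s /set_mem Es; rewrite /p (EN _ _ Es) (EN _ _ Es0).
  have s0ab : s0 \in `[a, b] by case: Es0.
  apply: (measurableT_comp (continuous_borel_measurable (ch _ (pab n s0 s0ab)))).
  by apply: measurable_funS mu_ => // s [].
move=> s sab; apply/cvgrPdist_lt => e e0.
have [r r0 hr] := hc (u s) s sab e e0.
near=> n; apply: hr; first exact: pab.
have [_ /andP[ps sp]] := pP n s sab.
rewrite ger0_norm ?subr_ge0// ltrBlDl (lt_trans sp)// ltrD2l.
by near: n; exact: (near_infty_natSinv_lt (PosNum r0)).
Unshelve. all: by end_near. Qed.

(** * Operations on trajectories *)

Definition mxsum {R : realType} {m n : nat} (M : 'M[R]_(m, n)) : R :=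
  \sum_i \sum_j `|M i j|.

Section matrix_bounds.
Context {R : realType}.

Lemma mxsum_ge0 m n (M : 'M[R]_(m, n)) : 0 <= mxsum M.
Proof. by apply: sumr_ge0 => i _; apply: sumr_ge0. Qed.

Lemma coord_mulmx_le m n (M : 'M[R]_(m, n)) (v : 'cV[R]_n) i :
  `|(M *m v) i 0| <= mxsum M * `|v|.
Proof.
rewrite mxE (le_trans (ler_norm_sum _ _ _))//.
apply: (@le_trans _ _ (\sum_j `|M i j| * `|v|)).
  by apply: ler_sum => j _; rewrite normrM ler_wpM2l// coord_le_norm.
rewrite -mulr_suml ler_wpM2r// /mxsum (bigD1 i)//= lerDl.
by apply: sumr_ge0 => l _; apply: sumr_ge0.
Qed.

Lemma norm_mulmx_le m n (M : 'M[R]_(m, n)) (v : 'cV[R]_n) :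
  `|M *m v| <= mxsum M * `|v|.
Proof.
apply: norm_le_of_coord => [|i]; first by rewrite mulr_ge0// mxsum_ge0.
exact: coord_mulmx_le.
Qed.

End matrix_bounds.

Lemma itvcc_setU (R : realType) (a b c : R) : a <= b -> b <= c ->
  `[a, c]%classic = `[a, b] `|` `[b, c].
Proof.
move=> ab bc; apply/seteqP; split=> [s|s []]/=; rewrite !in_itv/= => /andP[].
- by move=> -> ->; case: (leP s b) => [|/ltW ->]; [left|right].
- by move=> -> /le_trans ->.
- by move=> bs ->; rewrite (le_trans ab bs).
Qed.

Section real_integrals.
Context {R : realType}.
Notation mu := (@lebesgue_measure R).

Lemma is_derive_continuous (F f : R -> R) :
  (forall s : R, is_derive s (1 : R) F (f s)) -> continuous F.
Proof.
move=> dF s; apply: differentiable_continuous; apply/derivable1_diffP.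
by have [] := dF s.
Qed.

Lemma Rintegral_is_derive (F f : R -> R) (a b : R) : a <= b ->
  (forall s : R, is_derive s (1 : R) F (f s)) -> continuous f ->
  \int[mu]_(r in `[a, b]) f r = F b - F a.
Proof.
rewrite le_eqVlt => /predU1P[<- _ _|ab dF cf].
  by rewrite set_itv1 Rintegral_set1 subrr.
have cF := is_derive_continuous dF.
rewrite /Rintegral (@continuous_FTC2 _ _ F)//.
- exact: continuous_subspaceT.
- split; first by move=> s _; have [] := dF s.
    exact/cvg_at_right_filter/cF.
  exact/cvg_at_left_filter/cF.
- by move=> s _; rewrite derive1E; have [] := dF s.
Qed.

Lemma eq_Rintegral_bndo (a b : R) (f g : R -> R) :
  mu.-integrable `[a, b] (EFin \o f) -> mu.-integrable `[a, b] (EFin \o g) ->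
  (forall r, r \in `[a, b[ -> f r = g r) ->
  \int[mu]_(r in `[a, b]) f r = \int[mu]_(r in `[a, b]) g r.
Proof.
move=> fi gi fg.
have sub : `[a, b[ `<=` (`[a, b] : set R) by apply: subset_itv; rewrite bnd_simp.
have fi' : mu.-integrable `[a, b[ (EFin \o f) by apply: integrableS fi.
have gi' : mu.-integrable `[a, b[ (EFin \o g) by apply: integrableS gi.
rewrite -!Rintegral_itv_bndo_bndc//.
by apply: eq_Rintegral => r /set_mem; exact: fg.
Qed.

Lemma integrable_itv_cat (a b c : R) (f : R -> \bar R) : a <= b -> b <= c ->
  mu.-integrable `[a, b] f -> mu.-integrable `[b, c] f ->
  mu.-integrable `[a, c] f.
Proof.
move=> ab bc /integrableP[mf1 if1] /integrableP[mf2 if2].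
have mf : measurable_fun `[a, c] f by rewrite (itvcc_setU ab bc); apply/measurable_funU.
have ma : measurable_fun `[a, c] (abse \o f) by exact: measurableT_comp.
apply/integrableP; split=> //.
rewrite [X in (X < _)%E](_ : _ = (\int[mu]_(x in `[a, b]) `|f x| +
    \int[mu]_(x in `]b, c]) `|f x|)%E).
  rewrite lte_add_pinfty// (le_lt_trans _ if2)// ge0_subset_integral//=.
    exact: measurableT_comp.
  by apply: subset_itv; rewrite bnd_simp.
rewrite (@itv_bndbnd_setU _ _ _ (BRight b)) ?bnd_simp//.
rewrite ge0_integral_setU//=.
  by rewrite -(@itv_bndbnd_setU _ _ _ (BRight b)) ?bnd_simp.
apply/disj_setPS => y [/=]; rewrite 2!in_itv/= => /andP[_ yb] /andP[].
by rewrite ltNge yb.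
Qed.

End real_integrals.

Section in_L2_closure.
Context {R : realType} {k : nat}.
Implicit Types u v : R -> 'cV[R]_k.

Lemma in_L2_0 (a b : R) : in_Lp 2 a b (fun=> 0 : 'cV[R]_k).
Proof.
apply/in_L2P; split; first exact: measurable_cst.
rewrite (_ : (fun s => _) = EFin \o cst 0); first exact: integrable_itv_cst.
by apply/funext => s /=; rewrite enorm0 expr0n.
Qed.

Lemma in_L2_restrict (a b s t : R) u : a <= s -> t <= b ->
  in_Lp 2 a b u -> in_Lp 2 s t u.
Proof.
move=> as_ tb /in_L2P[mu_ iu]; apply/in_L2P.
have sub : `[s, t] `<=` (`[a, b] : set R) by apply: subset_itv; rewrite bnd_simp.
by split; [exact: measurable_funS mu_|exact: integrableS iu].
Qed.

Lemma measurable_itv_cat d (E : sigmaRingType d) (a b c : R) (u v w : R -> E) :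
  a <= b -> b <= c ->
  measurable_fun `[a, b] v -> measurable_fun `[b, c] w ->
  measurable_fun `[a, c] (fun s => if s < b then v s else w s).
Proof.
move=> ab bc mv mw.
have -> : `[a, c]%classic = `[a, b[ `|` `[b, c] :> set R.
  by rewrite (@itv_bndbnd_setU _ _ _ (BLeft b)) ?bnd_simp.
apply/measurable_funU => //; split.
  apply: (@eq_measurable_fun _ _ _ _ _ v).
    by move=> s /set_mem/=; rewrite in_itv/= => /andP[_ ->].
  by apply: measurable_funS mv => //; apply: subset_itv; rewrite bnd_simp.
apply: (@eq_measurable_fun _ _ _ _ _ w) => //.
by move=> s /set_mem/=; rewrite in_itv/= ltNge => /andP[-> _].
Qed.

Lemma in_L2_cat (a b c : R) u v : a <= b -> b <= c ->
  in_Lp 2 a b u -> in_Lp 2 b c v ->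
  in_Lp 2 a c (fun s => if s < b then u s else v s).
Proof.
move=> ab bc /in_L2P[mu_ iu] /in_L2P[mv iv]; apply/in_L2P.
have mw := @measurable_itv_cat _ (borel 'cV[R]_k) a b c u u v ab bc mu_ mv.
split=> //; apply: (integrable_itv_cat ab bc).
  have mN : measurable_fun `[a, b] (fun s => (enorm (if s < b then u s else v s) ^+ 2)%:E).
    apply/measurable_EFinP; apply: measurable_funX.
    apply: (measurableT_comp (@borel_enorm_measurable R k)).
    by apply: measurable_funS mw => //; apply: subset_itv; rewrite bnd_simp.
  apply/integrableP; split=> //.
  have /integrableP[_] := iu; apply: le_lt_trans.
  rewrite -integral_itv_bndo_bndc; last first.
    apply: measurableT_comp => //; apply: measurable_funS mN => //.
    by apply: subset_itv; rewrite bnd_simp.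
  rewrite -[leRHS]integral_itv_bndo_bndc; last first.
    apply: measurableT_comp => //; case/integrableP : iu => + _.
    by apply: measurable_funS => //; apply: subset_itv; rewrite bnd_simp.
  rewrite le_eqVlt; apply/orP; left; apply/eqP; apply: eq_integral => s.
  by move=> /set_mem/=; rewrite in_itv/= => /andP[_ ->].
apply: eq_integrable iv => // s /set_mem/=.
by rewrite in_itv/= ltNge => /andP[-> _].
Qed.

End in_L2_closure.

Section linear_trajectories.
Context {R : realType} {d k : nat} (A : 'M[R]_d) (B : 'M[R]_(d, k)).
Notation mu := (@lebesgue_measure R).
Variable Z : R -> 'M[R]_d.
Hypothesis Z0 : Z 0 = 1%:M.
Hypothesis dZ : forall (s : R) i j,
  is_derive s (1 : R) (fun t => Z t i j) ((A *m Z s) i j).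

Let dshift (tau s : R) i j :
  is_derive s (1 : R) (fun t => Z (t - tau) i j) ((A *m Z (s - tau)) i j).
Proof.
have E t : - tau + t *: (1 : R) = t - tau by rewrite [t *: 1]mulr1 addrC.
have dif : differentiable (fun t => Z t i j) (- tau + s *: (1 : R)).
  by apply/derivable1_diffP; have [] := dZ (- tau + s *: (1 : R)) i j.
have := derive_line dif; rewrite (_ : (fun t => _) = fun t => Z (t - tau) i j).
  by move=> H; apply: (is_derive_eq H); rewrite E; have [] := dZ (s - tau) i j.
by apply/funext => t; rewrite E.
Qed.

Let dfree (tau : R) (y : 'cV[R]_d) (s : R) i :
  is_derive s (1 : R) (fun t => (Z (t - tau) *m y) i 0) ((A *m (Z (s - tau) *m y)) i 0).
Proof.
rewrite (_ : (fun t => _) = \sum_j (fun t => Z (t - tau) i j * y j 0)); last first.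
  by apply/funext => t; rewrite fct_sumE mxE.
rewrite mulmxA mxE; apply: is_derive_sum => j.
have := @is_deriveM R _ _ _ s 1 _ _ (dshift tau s i j) (is_derive_cst (y j 0) s 1).
move=> H; apply: (is_derive_eq H).
by rewrite /GRing.scale/= mulr0 add0r mulrC.
Qed.

Lemma free_continuous (tau : R) (y : 'cV[R]_d) :
  continuous (fun s => Z (s - tau) *m y).
Proof.
move=> s; apply: differentiable_continuous; apply/derivable1_diffP.
by apply/derivable_mxP => i j; rewrite (ord1 j); have [] := dfree tau y s i.
Qed.

Lemma free_Rintegral (tau : R) (y : 'cV[R]_d) (a b : R) i : a <= b ->
  \int[mu]_(r in `[a, b]) (A *m (Z (r - tau) *m y)) i 0 =
  (Z (b - tau) *m y) i 0 - (Z (a - tau) *m y) i 0.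
Proof.
move=> ab; rewrite -(Rintegral_is_derive ab (fun s => dfree tau y s i))//.
have cf j : continuous (fun r => (Z (r - tau) *m y) j 0).
  exact: is_derive_continuous (fun s => dfree tau y s j).
rewrite (_ : (fun r => _) = fun r => \sum_j A i j * (Z (r - tau) *m y) j 0); last first.
  by apply/funext => t; rewrite mxE.
move=> r; apply: cvg_big => [|j _]; first exact: add_continuous.
by apply: cvgMr; exact: cf.
Qed.

Lemma trajectory_free (t T : R) (x : 'cV[R]_d) :
  trajectory A B t T x (fun=> 0) (fun s => Z (s - t) *m x).
Proof.
split; first by apply: continuous_subspaceT; exact: free_continuous.
move=> s; rewrite in_itv/= => /andP[ts _] i.
under eq_Rintegral do rewrite mulmx0 addr0.
by rewrite free_Rintegral// subrr Z0 mul1mx [RHS]addrC subrK.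
Qed.

Lemma trajectory_shift (t T : R) (x y : 'cV[R]_d) u g : in_Lp 1 t T u ->
  trajectory A B t T x u g ->
  trajectory A B t T y u (fun s => g s + Z (s - t) *m (y - x)).
Proof.
move=> iu [cg gE]; have [cz zE] := trajectory_free t T (y - x).
split; first exact: within_continuousD.
move=> s sT i; rewrite mxE gE// zE//.
have /andP[ts sT'] : t <= s <= T by move: sT; rewrite in_itv.
have i1 : mu.-integrable `[t, s] (EFin \o (fun r => (A *m g r + B *m u r) i 0)).
  exact: integrable_itvS (integrable_dynamics A B i iu cg).
have i2 : mu.-integrable `[t, s] (EFin \o
    (fun r => (A *m (Z (r - t) *m (y - x)) + B *m (0 : 'cV[R]_k)) i 0)).
  have iz := @integrable_dynamics R d k A B t T (fun=> 0) _ i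
    (in_L2_L1 (in_L2_0 t T)) cz.
  exact: integrable_itvS iz.
rewrite addrACA -RintegralD//; congr (_ + _).
  by rewrite !mxE addrC subrK.
apply: eq_Rintegral => r _.
by rewrite mulmx0 addr0 !mulmxDr addrAC [RHS]mxE.
Qed.

End linear_trajectories.

Section trajectory_operations.
Context {R : realType} {d k : nat} (A : 'M[R]_d) (B : 'M[R]_(d, k)).
Notation mu := (@lebesgue_measure R).

Lemma trajectory_init (t T : R) x (u : R -> 'cV[R]_k) g : t <= T ->
  trajectory A B t T x u g -> g t = x.
Proof.
move=> tT [_ gE]; apply/matrixP => i j; rewrite (ord1 j) gE ?in_itv/= ?lexx//.
by rewrite set_itv1 Rintegral_set1 addr0.
Qed.

Lemma trajectory_restrict (t s T : R) x (u : R -> 'cV[R]_k) g :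
  in_Lp 1 t T u -> t <= s -> trajectory A B t T x u g ->
  trajectory A B s T (g s) u g.
Proof.
move=> iu ts tg; have [cg gE] := tg; split.
  by apply: continuous_subspaceW cg; apply: subset_itv; rewrite bnd_simp.
move=> r; rewrite in_itv/= => /andP[sr rT] i.
by rewrite -(trajectory_increment i iu tg ts sr rT) addrC subrK.
Qed.

Lemma trajectory_cat (a b c : R) x (u v : R -> 'cV[R]_k) g h :
  a <= b -> b <= c -> in_Lp 2 a b u -> in_Lp 2 b c v ->
  trajectory A B a b x u g -> trajectory A B b c (g b) v h ->
  trajectory A B a c x (fun s => if s < b then u s else v s)
                       (fun s => if s < b then g s else h s).
Proof.
move=> ab bc iu iv tg th; have [cg gE] := tg; have [ch hE] := th.
have hb : h b = g b := trajectory_init bc th.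
set w := fun s => if s < b then u s else v s.
set f := fun s => if s < b then g s else h s.
have cf1 : {within `[a, b], continuous f}.
  apply: (@subspace_eq_continuous _ _ _ g) cg => s /set_mem/=.
  rewrite in_itv/= /f /from_subspace /= => /andP[_].
  by rewrite le_eqVlt => /predU1P[->|->//]; rewrite ltxx hb.
have cf2 : {within `[b, c], continuous f}.
  apply: (@subspace_eq_continuous _ _ _ h) ch => s /set_mem/=.
  by rewrite in_itv/= /f /from_subspace ltNge => /andP[->].
have cf : {within `[a, c], continuous f}.
  rewrite (itvcc_setU ab bc).
  by apply: withinU_continuous => //; exact: itv_closed.
split=> // s; rewrite in_itv/= => /andP[as_ sc] i.
have iw : in_Lp 2 a c w := in_L2_cat ab bc iu iv.
have fi := integrable_dynamics A B i (in_L2_L1 iw) cf.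
have gi := integrable_dynamics A B i (in_L2_L1 iu) cg.
have E1 r : a <= r -> r <= b ->
    \int[mu]_(z in `[a, r]) (A *m f z + B *m w z) i 0 =
    \int[mu]_(z in `[a, r]) (A *m g z + B *m u z) i 0.
  move=> ar rb; apply: eq_Rintegral_bndo.
  - by apply: integrable_itvS fi => //; exact: le_trans bc.
  - exact: integrable_itvS gi.
  by move=> z; rewrite in_itv/= /f /w => /andP[_ zr]; rewrite (lt_le_trans zr rb).
have [sb|bs] := ltP s b.
  by rewrite E1 ?(ltW sb)// {1}/f sb gE// in_itv/= as_ (ltW sb).
rewrite (Rintegral_itv_split ab bs); last exact: integrable_itvS fi.
rewrite E1// addrA -gE ?in_itv/= ?ab ?lexx//.
rewrite {1}/f ltNge bs/= hE ?in_itv/= ?bs//; congr (_ + _).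
apply: eq_Rintegral => z /set_mem/=; rewrite in_itv/= => /andP[bz _].
by rewrite /f /w ltNge bz.
Qed.

End trajectory_operations.

Lemma ler_dist_add (R : realDomainType) (v w p q : R) :
  v <= w + p -> w <= v + q -> 0 <= p -> 0 <= q -> `|v - w| <= p + q.
Proof. by move=> vw wv p0 q0; rewrite ler_norml; apply/andP; split; lra. Qed.

(** * Lipschitz estimates for a coercive control problem *)

Section control_problem.
Context {R : realType} {d k : nat} (A : 'M[R]_d) (B : 'M[R]_(d, k)) (T : R).
Notation mu := (@lebesgue_measure R).
Implicit Types (t s : R) (x y : 'cV[R]_d) (u : R -> 'cV[R]_k) (g : R -> 'cV[R]_d).
Variables (l : R -> 'cV[R]_d -> 'cV[R]_k -> R) (h : 'cV[R]_d -> R).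

Definition control_cost (t : R) (u : R -> 'cV[R]_k) (g : R -> 'cV[R]_d) : R :=
  \int[mu]_(s in `[t, T]) l s (g s) (u s) + h (g T).

Definition admissible (t : R) x (u : R -> 'cV[R]_k) (g : R -> 'cV[R]_d) :=
  in_Lp 2 t T u /\ trajectory A B t T x u g.

Definition control_value (t : R) x : R :=
  inf [set r | exists u g, admissible t x u g /\ r = control_cost t u g].

Definition energy (a b : R) (u : R -> 'cV[R]_k) : R :=
  \int[mu]_(s in `[a, b]) enorm (u s) ^+ 2.

Variables (c C M K : R).
Hypothesis c_gt0 : 0 < c.
Hypothesis C_ge0 : 0 <= C.
Hypothesis K_ge0 : 0 <= K.
Hypothesis l_coercive : forall s x (v : 'cV[R]_k), 0 <= s <= T ->
  c * enorm v ^+ 2 - C <= l s x v.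
Hypothesis l_growth : forall s x (v : 'cV[R]_k), 0 <= s <= T ->
  `|l s x v| <= C * (1 + enorm v ^+ 2).
Hypothesis l_lipschitz : forall s x y (v : 'cV[R]_k), 0 <= s <= T ->
  `|l s x v - l s y v| <= C * (1 + enorm v ^+ 2) * `|x - y|.
Hypothesis l_measurable : forall (a b : R) u g, 0 <= a -> b <= T ->
  measurable_fun `[a, b] (u : R -> borel 'cV[R]_k) ->
  {within `[a, b], continuous g} ->
  measurable_fun `[a, b] (fun s => l s (g s) (u s)).
Hypothesis h_bounded : forall x, `|h x| <= M.
Hypothesis h_lipschitz : forall x y, `|h x - h y| <= K * `|x - y|.

Let M_ge0 : 0 <= M. Proof. exact: le_trans (h_bounded 0). Qed.

Lemma Rintegral_itv_cst (a b r : R) : a <= b ->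
  \int[mu]_(_ in `[a, b]) r = r * (b - a).
Proof.
rewrite le_eqVlt => /predU1P[<-|ab].
  by rewrite set_itv1 Rintegral_set1 subrr mulr0.
by rewrite Rintegral_cst//= lebesgue_measure_itv/= lte_fin ab.
Qed.

Let integrable_growth (a b r : R) u : in_Lp 2 a b u ->
  mu.-integrable `[a, b] (EFin \o (fun s => r * (1 + enorm (u s) ^+ 2))).
Proof.
move=> /in_L2P[_ iu].
exact: (integrableZl _ r (integrableD _ (integrable_itv_cst a b 1) iu)).
Qed.

Let Rintegral_growth (a b r : R) u : a <= b -> in_Lp 2 a b u ->
  \int[mu]_(s in `[a, b]) (r * (1 + enorm (u s) ^+ 2)) =
  r * ((b - a) + energy a b u).
Proof.
move=> ab /[dup] iu2 /in_L2P[_ iu].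
have i1 : mu.-integrable `[a, b] (EFin \o cst 1) by exact: integrable_itv_cst.
have i2 : mu.-integrable `[a, b] (EFin \o (fun s => 1 + enorm (u s) ^+ 2)).
  exact: integrableD i1 iu.
rewrite RintegralZl//; congr (_ * _).
by rewrite RintegralD// Rintegral_itv_cst// mul1r.
Qed.

Lemma integrable_running_cost (a b : R) u g : 0 <= a -> b <= T ->
  in_Lp 2 a b u -> {within `[a, b], continuous g} ->
  mu.-integrable `[a, b] (EFin \o (fun s => l s (g s) (u s))).
Proof.
move=> a0 bT iu cg; apply: le_integrable (integrable_growth C iu) => //.
  by apply/measurable_EFinP; apply: l_measurable => //; case/in_L2P: iu.
move=> s /=; rewrite in_itv/= => /andP[as_ sb]; rewrite lee_fin.
rewrite (le_trans (l_growth _ _ _))//; last exact: ler_norm.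
by rewrite (le_trans a0 as_) (le_trans sb bT).
Qed.

Lemma energy_ge0 a b u : 0 <= energy a b u.
Proof. by apply: Rintegral_ge0 => s _; exact: sqr_ge0. Qed.

Lemma running_cost_ge (a b : R) u g : 0 <= a -> a <= b -> b <= T ->
  in_Lp 2 a b u -> {within `[a, b], continuous g} ->
  c * energy a b u - C * (b - a) <= \int[mu]_(s in `[a, b]) l s (g s) (u s).
Proof.
move=> a0 ab bT iu cg; have [_ iu2] := (in_L2P _ _ _).1 iu.
have ic : mu.-integrable `[a, b] (EFin \o cst C) by exact: integrable_itv_cst.
have iuc : mu.-integrable `[a, b] (EFin \o (fun s => c * enorm (u s) ^+ 2)).
  exact: (integrableZl _ c iu2).
rewrite /energy -RintegralZl// -(Rintegral_itv_cst C ab) -RintegralB//.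
apply: le_Rintegral => //; last 2 first.
- exact: integrable_running_cost.
- move=> s /=; rewrite in_itv/= => /andP[as_ sb]; apply: l_coercive.
  by rewrite (le_trans a0 as_) (le_trans sb bT).
exact: integrableB iuc ic.
Qed.

Lemma control_cost_ge t x u g : 0 <= t <= T -> admissible t x u g ->
  c * energy t T u - C * T - M <= control_cost t u g.
Proof.
move=> /andP[t0 tT] [iu [cg _]]; rewrite /control_cost lerD//; last first.
  by have := h_bounded (g T); rewrite ler_norml => /andP[].
apply: le_trans (running_cost_ge t0 tT (lexx T) iu cg).
by rewrite lerD2l lerN2 ler_wpM2l// lerBlDr lerDl.
Qed.

Lemma control_costs_lbound t x : 0 <= t <= T ->
  has_lbound [set r | exists u g, admissible t x u g /\ r = control_cost t u g].
Proof.
move=> tT; exists (- C * T - M) => _ [u [g [ug ->]]].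
apply: le_trans (control_cost_ge tT ug).
have : 0 <= c * energy t T u by rewrite mulr_ge0 ?energy_ge0// ltW.
by lra.
Qed.

Lemma control_value_le t x u g : 0 <= t <= T -> admissible t x u g ->
  control_value t x <= control_cost t u g.
Proof. by move=> tT ug; apply: ge_inf; [exact: control_costs_lbound|exists u, g]. Qed.

Variable Z : R -> 'M[R]_d.
Hypothesis Z0 : Z 0 = 1%:M.
Hypothesis dZ : forall (s : R) i j,
  is_derive s (1 : R) (fun t => Z t i j) ((A *m Z s) i j).
Variable kappa : R.
Hypothesis Z_bounded : forall s, 0 <= s <= T -> mxsum (Z s) <= kappa.

Let admissible_free t x : admissible t x (fun=> 0) (fun s => Z (s - t) *m x).
Proof. by split; [exact: in_L2_0|exact: trajectory_free]. Qed.

Lemma control_costs_nonempty t x :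
  [set r | exists u g, admissible t x u g /\ r = control_cost t u g] !=set0.
Proof.
by eexists; exists (fun=> 0), (fun s => Z (s - t) *m x); split; last reflexivity.
Qed.

Lemma control_value_adherent t x e : 0 <= t <= T -> 0 < e ->
  exists u g, admissible t x u g /\ control_cost t u g < control_value t x + e.
Proof.
move=> tT e0; have := @inf_adherent _ _ e e0
  (conj (control_costs_nonempty t x) (control_costs_lbound x tT)).
by move=> [_ [u [g [ug ->]]] H]; exists u, g.
Qed.

Lemma control_value_ub t x : 0 <= t <= T -> control_value t x <= C * T + M.
Proof.
move=> tT'; have /andP[t0 tT] := tT'.
apply: le_trans (control_value_le tT' (admissible_free t x)) _.
have [iu [cg _]] := admissible_free t x.
rewrite lerD//; last by have := h_bounded (Z (T - t) *m x); rewrite ler_norml => /andP[].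
apply: (@le_trans _ _ (C * (T - t))); last first.
  by rewrite ler_wpM2l// lerBlDr lerDl.
rewrite -Rintegral_itv_cst//; apply: le_Rintegral => //.
- exact: integrable_running_cost.
- exact: integrable_itv_cst.
move=> s /=; rewrite in_itv/= => /andP[ts sT].
rewrite (le_trans (ler_norm _))// (le_trans (l_growth _ _ _)) ?(le_trans t0 ts)//.
by rewrite enorm0 expr0n addr0 mulr1.
Qed.

Let E0 := (2 * (C * T) + 2 * M + 1) / c.

Lemma energy_near_minimizer t x u g : 0 <= t <= T -> admissible t x u g ->
  control_cost t u g <= control_value t x + 1 -> energy t T u <= E0.
Proof.
move=> tT ug H; rewrite ler_pdivlMr// mulrC.
by have := control_cost_ge tT ug; have := control_value_ub x tT; lra.
Qed.

Let Lam := (C * (T + E0) + K) * kappa.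

Let T_ge0 t : 0 <= t <= T -> 0 <= T.
Proof. by move=> /andP[]; exact: le_trans. Qed.

Let kappa_ge0 t : 0 <= t <= T -> 0 <= kappa.
Proof. by move=> tT; apply: le_trans (Z_bounded tT); exact: mxsum_ge0. Qed.

Lemma control_value_lipschitz_space t x y : 0 <= t <= T ->
  control_value t y <= control_value t x + Lam * `|y - x|.
Proof.
move=> tT'; have /andP[t0 tT] := tT'; apply/ler_addgt0Pr => e e0.
pose e' := Num.min e 1.
have e'0 : 0 < e' by rewrite lt_min e0 ltr01.
have [u [g [ug Ju]]] := control_value_adherent x tT' e'0.
have Eu : energy t T u <= E0.
  apply: energy_near_minimizer tT' ug _; apply: (le_trans (ltW Ju)).
  by rewrite lerD2l ge_min lexx orbT.
have [iu tg] := ug; have [cg _] := tg.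
pose g' s := g s + Z (s - t) *m (y - x).
have tg' : trajectory A B t T y u g'.
  apply: (trajectory_shift Z0 dZ) tg; exact: in_L2_L1.
have [cg' _] := tg'.
apply: (le_trans (control_value_le tT' (conj iu tg'))).
have g'g s : t <= s <= T -> `|g' s - g s| <= kappa * `|y - x|.
  move=> /andP[ts sT]; rewrite /g' addrC addKr (le_trans (norm_mulmx_le _ _))//.
  rewrite ler_wpM2r// Z_bounded// subr_ge0 ts lerBlDr (le_trans sT)//.
  by rewrite lerDl.
have il := integrable_running_cost t0 (lexx T) iu cg.
have il' := integrable_running_cost t0 (lexx T) iu cg'.
have le1 : \int[mu]_(s in `[t, T]) l s (g' s) (u s) <=
    \int[mu]_(s in `[t, T]) l s (g s) (u s) + C * (T + E0) * (kappa * `|y - x|).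
  have le2 : \int[mu]_(s in `[t, T])
      ((C * (kappa * `|y - x|)) * (1 + enorm (u s) ^+ 2)) <=
      C * (T + E0) * (kappa * `|y - x|).
    rewrite Rintegral_growth// [leRHS]mulrAC ler_wpM2l//.
      by rewrite mulr_ge0// mulr_ge0// (kappa_ge0 tT').
    by rewrite lerD// lerBlDr lerDl.
  apply: le_trans (lerD (lexx _) le2).
  rewrite -RintegralD//; last exact: integrable_growth.
  apply: le_Rintegral => //.
    exact: integrableD il (integrable_growth _ iu).
  move=> s /=; rewrite in_itv/= => /andP[ts sT]; rewrite -lerBlDl.
  rewrite (le_trans (ler_norm _))// (le_trans (l_lipschitz _ _ _ _)) ?(le_trans t0 ts)//.
  rewrite mulrAC ler_wpM2r ?addr_ge0 ?sqr_ge0//.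
  by rewrite ler_wpM2l// g'g// ts sT.
have le3 : h (g' T) <= h (g T) + K * (kappa * `|y - x|).
  rewrite -lerBlDl (le_trans (ler_norm _))// (le_trans (h_lipschitz _ _))//.
  by rewrite ler_wpM2l// g'g// tT lexx.
have e'e : e' <= e by rewrite ge_min lexx.
rewrite /control_cost /Lam; move: Ju; rewrite /control_cost.
rewrite mulrDl mulrDl -!mulrA; lra.
Qed.

Let Lam_ge0 t : 0 <= t <= T -> 0 <= Lam.
Proof.
move=> tT; rewrite /Lam mulr_ge0 ?(kappa_ge0 tT)// addr_ge0// mulr_ge0//.
rewrite addr_ge0 ?(T_ge0 tT)// /E0 divr_ge0 ?(ltW c_gt0)//.
by rewrite !addr_ge0// mulr_ge0// mulr_ge0// (T_ge0 tT).
Qed.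

Let control_cost_split t t' u g : 0 <= t -> t <= t' -> t' <= T ->
  in_Lp 2 t T u -> {within `[t, T], continuous g} ->
  control_cost t u g = \int[mu]_(s in `[t, t']) l s (g s) (u s) + control_cost t' u g.
Proof.
move=> t0 tt' t'T iu cg; rewrite /control_cost.
by rewrite (Rintegral_itv_split tt' t'T) ?addrA//; exact: integrable_running_cost.
Qed.

(* Start with the zero control on [[t, t']], then follow a near-optimal control. *)
Lemma control_value_time_ge t t' x : 0 <= t -> t <= t' -> t' <= T ->
  control_value t x <=
  control_value t' x + (C + Lam * (mxsum A * (kappa * `|x|))) * (t' - t).
Proof.
move=> t0 tt' t'T.
have tT : 0 <= t <= T by rewrite t0 (le_trans tt').
have tT' : 0 <= t' <= T by rewrite t'T (le_trans t0).
set z := Z (t' - t) *m x.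
have zx : `|z - x| <= mxsum A * (kappa * `|x|) * (t' - t).
  apply: norm_le_of_coord => [|i].
    rewrite mulr_ge0 ?subr_ge0// mulr_ge0 ?mxsum_ge0//.
    by rewrite mulr_ge0// (kappa_ge0 tT).
  have := free_Rintegral dZ t x i tt'; rewrite subrr Z0 mul1mx -/z => E.
  rewrite [X in `|X|]mxE [X in _ + X]mxE -E.
  have cf : {within `[t, t'], continuous (fun s => Z (s - t) *m x)}.
    by apply: continuous_subspaceT; exact: (free_continuous dZ).
  have fi : mu.-integrable `[t, t'] (EFin \o (fun r => (A *m (Z (r - t) *m x)) i 0)).
    have := integrable_dynamics A B i (in_L2_L1 (in_L2_0 t t')) cf.
    apply: eq_integrable => // r _ /=.
    by rewrite mulmx0 addr0.
  rewrite (le_trans (le_normr_Rintegral _ fi))//.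
  rewrite -Rintegral_itv_cst//; apply: le_Rintegral => //.
  - exact: integrable_norm.
  - exact: integrable_itv_cst.
  move=> r /=; rewrite in_itv/= => /andP[tr rt'].
  rewrite (le_trans (coord_mulmx_le _ _ _))// ler_wpM2l ?mxsum_ge0//.
  rewrite (le_trans (norm_mulmx_le _ _))// ler_wpM2r// Z_bounded//.
  by rewrite subr_ge0 tr lerBlDr (le_trans rt')// (le_trans t'T)// lerDl.
apply/ler_addgt0Pr => e e0.
have [u [g [[iu tg] Ju]]] := control_value_adherent z tT' e0.
have [i0 tf] := admissible_free t x.
have i0' : in_Lp 2 t t' (fun=> 0 : 'cV[R]_k) by exact: in_L2_0.
have tf' : trajectory A B t t' x (fun=> 0) (fun s => Z (s - t) *m x).
  exact: trajectory_free.
have tw := trajectory_cat tt' t'T i0' iu tf' tg.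
have iw := in_L2_cat tt' t'T i0' iu.
set w := (fun s => if s < t' then 0 else u s) in iw tw.
set f := (fun s => if s < t' then Z (s - t) *m x else g s) in tw.
have [cw _] := tw; have [cf' _] := tf'.
apply: (le_trans (control_value_le tT (conj iw tw))).
rewrite (control_cost_split t0 tt' t'T iw cw).
have E1 : control_cost t' w f = control_cost t' u g.
  rewrite /control_cost {2}/f ltNge t'T/=; congr (_ + _).
  apply: eq_Rintegral => s /set_mem/=; rewrite in_itv/= => /andP[t's _].
  by rewrite /w /f ltNge t's.
have sub : {within `[t, t'], continuous f}.
  by apply: continuous_subspaceW cw; apply: subset_itv; rewrite bnd_simp.
have iw' : in_Lp 2 t t' w := in_L2_restrict (lexx t) t'T iw.
have I1 : \int[mu]_(s in `[t, t']) l s (f s) (w s) <= C * (t' - t).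
  rewrite (@eq_Rintegral_bndo _ _ _ _ (fun s => l s (Z (s - t) *m x) 0)); last 3 first.
  - exact: (integrable_running_cost t0 t'T iw' sub).
  - exact: (integrable_running_cost t0 t'T i0' cf').
  - by move=> r; rewrite in_itv/= => /andP[_ rt']; rewrite /f /w rt'.
  rewrite -Rintegral_itv_cst//; apply: le_Rintegral => //.
  - exact: (integrable_running_cost t0 t'T i0' cf').
  - exact: integrable_itv_cst.
  move=> s /=; rewrite in_itv/= => /andP[ts st'].
  rewrite (le_trans (ler_norm _))// (le_trans (l_growth _ _ _)) ?(le_trans t0 ts) ?(le_trans st')//.
  by rewrite enorm0 expr0n addr0 mulr1.
have Vz := control_value_lipschitz_space x z tT'.
have : Lam * `|z - x| <= Lam * (mxsum A * (kappa * `|x|) * (t' - t)).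
  by rewrite ler_wpM2l// (Lam_ge0 tT).
rewrite E1 mulrDl -[Lam * _ * (t' - t)]mulrA; lra.
Qed.

(* The displacement on [[t, t']] costs at most [int |u|], which the coercive
   part [c int |u|^2] of the running cost absorbs by Young's inequality. *)
Lemma control_value_time_le t t' x : 0 <= t -> t <= t' -> t' <= T ->
  mxsum A * (t' - t) <= 2^-1 ->
  control_value t' x <=
  control_value t x + (C + Lam * (2 * (mxsum A * `|x|)) + (Lam * mxsum B) ^+ 2 / c) * (t' - t).
Proof.
move=> t0 tt' t'T small.
have tT : 0 <= t <= T by rewrite t0 (le_trans tt').
have tT' : 0 <= t' <= T by rewrite t'T (le_trans t0).
set a := mxsum A in small *; set b := mxsum B.
have a0 : 0 <= a by exact: mxsum_ge0.
have b0 : 0 <= b by exact: mxsum_ge0.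
have L0 := Lam_ge0 tT.
apply/ler_addgt0Pr => e e0.
have [u [g [[iu tg] Ju]]] := control_value_adherent x tT e0.
have [cg _] := tg.
have iu' : in_Lp 2 t t' u by exact: in_L2_restrict iu.
have iu'' : in_Lp 2 t' T u by exact: in_L2_restrict iu.
have cg' : {within `[t, t'], continuous g}.
  by apply: continuous_subspaceW cg; apply: subset_itv; rewrite bnd_simp.
have tr : trajectory A B t' T (g t') u g := trajectory_restrict (in_L2_L1 iu) tt' tg.
have [_ iu1] := in_L1P (in_L2_L1 iu').
have [_ iu2] := (in_L2P _ _ _).1 iu'.
set W := \int[mu]_(s in `[t, t']) enorm (u s).
have ibu : mu.-integrable `[t, t'] (EFin \o (fun s => b * enorm (u s))).
  exact: (integrableZl _ b iu1).
have gx : `|g t' - x| <= 2 * (a * `|x|) * (t' - t) + 2 * (b * W).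
  have cn : {within `[t, t'], continuous (fun s => `|g s - x|)}.
    move=> s; apply: (@continuous_comp _ _ _ (fun s : subspace _ => g s - x) Num.norm).
      by apply: cvgB; [exact: cg'|exact: cvg_cst].
    exact: norm_continuous.
  have [s0 s0t Smax] := EVT_max tt' cn.
  set S := `|g s0 - x| in Smax.
  have S0 : 0 <= S by rewrite /S.
  have gS : `|g t' - x| <= S by apply: Smax; rewrite in_itv/= tt' lexx.
  have /andP[ts0 s0t'] : t <= s0 <= t' by move: s0t; rewrite in_itv.
  have iphi : mu.-integrable `[t, t'] (EFin \o (fun s => a * (`|x| + S) + b * enorm (u s))).
    exact: integrableD (integrable_itv_cst t t' (a * (`|x| + S))) ibu.
  have phiE : \int[mu]_(s in `[t, t']) (a * (`|x| + S) + b * enorm (u s)) =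
      a * (`|x| + S) * (t' - t) + b * W.
    rewrite RintegralD//; last exact: (integrable_itv_cst t t' (a * (`|x| + S))).
    by rewrite Rintegral_itv_cst// RintegralZl.
  have S1 : S <= a * (`|x| + S) * (t' - t) + b * W.
    have ph0 s : 0 <= a * (`|x| + S) + b * enorm (u s).
      by apply: addr_ge0; apply: mulr_ge0 => //; [exact: addr_ge0|exact: enorm_ge0].
    rewrite -phiE; apply: norm_le_of_coord => [|i].
      by apply: Rintegral_ge0.
    have gt : g t = x by apply: trajectory_init tg; rewrite (le_trans tt').
    rewrite [X in `|X|]mxE [X in _ + X]mxE -[in X in _ - X]gt.
    rewrite (trajectory_increment i (in_L2_L1 iu) tg (lexx t) ts0 (le_trans s0t' t'T)).
    have fi := integrable_dynamics A B i (in_L2_L1 iu') cg'.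
    have fi0 := integrable_itvS (lexx t) s0t' fi.
    rewrite (le_trans (le_normr_Rintegral _ fi0))//.
    rewrite [leRHS](Rintegral_itv_split ts0 s0t' iphi).
    rewrite -[leLHS]addr0 lerD//; last by apply: Rintegral_ge0.
    apply: le_Rintegral => //.
    - exact: integrable_norm.
    - exact: integrable_itvS iphi.
    move=> r /=; rewrite in_itv/= => /andP[tr' rs0].
    rewrite mxE (le_trans (ler_normD _ _))// lerD//.
      rewrite (le_trans (coord_mulmx_le _ _ _))// ler_wpM2l//.
      rewrite -[g r](subrK x) addrC (le_trans (ler_normD _ _))// lerD2l Smax//.
      by rewrite in_itv/= tr' (le_trans rs0).
    rewrite (le_trans (coord_mulmx_le _ _ _))// ler_wpM2l//.
    exact: norm_le_enorm.
  have : a * (t' - t) * S <= 2^-1 * S by rewrite ler_wpM2r.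
  have E : a * (`|x| + S) * (t' - t) = a * `|x| * (t' - t) + a * (t' - t) * S.
    by ring.
  by move: S1 gS; rewrite E; lra.
have young : 2 * Lam * b * W <= c * energy t t' u + (Lam * b) ^+ 2 / c * (t' - t).
  rewrite /W /energy -RintegralZl//.
  rewrite -[X in _ <= X + _]RintegralZl// -(Rintegral_itv_cst _ tt').
  have ic2 : mu.-integrable `[t, t'] (EFin \o (fun s => c * enorm (u s) ^+ 2)).
    exact: (integrableZl _ c iu2).
  have icst := integrable_itv_cst t t' ((Lam * b) ^+ 2 / c).
  rewrite -RintegralD//; apply: le_Rintegral => //.
  - exact: (integrableZl _ (2 * Lam * b) iu1).
  - exact: integrableD ic2 icst.
  move=> s _; rewrite -subr_ge0.
  have -> : c * enorm (u s) ^+ 2 + (Lam * b) ^+ 2 / c - 2 * Lam * b * enorm (u s) =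
    (c * enorm (u s) - Lam * b) ^+ 2 / c by field; exact: lt0r_neq0.
  by rewrite divr_ge0 ?sqr_ge0// ltW.
have Jge := running_cost_ge t0 tt' t'T iu' cg'.
have V1 := control_value_lipschitz_space (g t') x tT'.
have V2 := control_value_le tT' (conj iu'' tr).
move: Ju; rewrite (control_cost_split t0 tt' t'T iu cg) => Ju.
have : Lam * `|x - g t'| <= Lam * (2 * (a * `|x|) * (t' - t) + 2 * (b * W)).
  by rewrite distrC ler_wpM2l.
move: young Jge V1 V2 Ju; move: (Lam) (control_value _ _) L0 {gx} => Lm V L0.
lra.
Qed.

Lemma control_value_local_lipschitz (X : R) : exists2 N : R, 0 <= N &
  forall t t' x y, 0 <= t <= T -> 0 <= t' <= T -> `|x| <= X -> `|y| <= X ->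
  mxsum A * `|t - t'| <= 2^-1 ->
  `|control_value t x - control_value t' y| <= N * (`|t - t'| + `|x - y|).
Proof.
have [tT0|T0] := leP 0 T; last first.
  exists 0 => // t t' x y /andP[t0 tT]; have := le_trans t0 tT.
  by rewrite leNgt T0.
have z0 : 0 <= (0 : R) <= T by rewrite tT0 lexx.
have L0 := Lam_ge0 z0; have k0 := kappa_ge0 z0.
have a0 := mxsum_ge0 A.
pose N1 := C + Lam * (mxsum A * (kappa * `|X|)).
pose N2 := C + Lam * (2 * (mxsum A * `|X|)) + (Lam * mxsum B) ^+ 2 / c.
have N10 : 0 <= N1.
  by apply: addr_ge0 => //; apply: mulr_ge0 => //; apply: mulr_ge0 => //; exact: mulr_ge0.
have N20 : 0 <= N2.
  apply: addr_ge0; last by apply: divr_ge0; [exact: sqr_ge0|exact: ltW].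
  by apply: addr_ge0 => //; apply: mulr_ge0 => //; apply: mulr_ge0 => //; exact: mulr_ge0.
have time t t' x : 0 <= t -> t <= t' -> t' <= T -> `|x| <= X ->
    mxsum A * (t' - t) <= 2^-1 ->
    `|control_value t x - control_value t' x| <= (N1 + N2) * (t' - t).
  move=> t0 tt' t'T xX small; have tt0 : 0 <= t' - t by rewrite subr_ge0.
  have xX' : `|x| <= `|X| := le_trans xX (ler_norm X).
  have H1 : (C + Lam * (mxsum A * (kappa * `|x|))) * (t' - t) <= N1 * (t' - t).
    by rewrite ler_wpM2r// lerD2l !ler_wpM2l.
  have H2 : (C + Lam * (2 * (mxsum A * `|x|)) + (Lam * mxsum B) ^+ 2 / c) * (t' - t)
      <= N2 * (t' - t).
    by rewrite ler_wpM2r// lerD2r lerD2l !ler_wpM2l.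
  have G1 := le_trans (control_value_time_ge x t0 tt' t'T) (lerD (lexx _) H1).
  have G2 := le_trans (control_value_time_le x t0 tt' t'T small) (lerD (lexx _) H2).
  have P1 : 0 <= N1 * (t' - t) by rewrite mulr_ge0.
  have P2 : 0 <= N2 * (t' - t) by rewrite mulr_ge0.
  rewrite mulrDl; move: G1 G2 P1 P2 => {H1 H2}.
  move: (N1 * _) (N2 * _) => p q G1 G2 P1 P2.
  exact: ler_dist_add.
have space t x y : 0 <= t <= T ->
    `|control_value t x - control_value t y| <= Lam * `|x - y|.
  move=> tT; have := control_value_lipschitz_space x y tT.
  have := control_value_lipschitz_space y x tT.
  rewrite (distrC y x) ler_norml; move: (Lam * _) => p ??.
  by apply/andP; split; lra.
have N0 : 0 <= N1 + N2 by exact: addr_ge0.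
exists (N1 + N2 + Lam); first exact: addr_ge0.
move=> t t' x y tT t'T xX yX small.
have H : `|control_value t x - control_value t' x| <= (N1 + N2) * `|t - t'|.
  have /andP[t0 tT2] := tT; have /andP[t'0 t'T2] := t'T.
  have [tt'|t't] := leP t t'.
    move: small; rewrite distrC ger0_norm ?subr_ge0// => small.
    exact: time.
  move: small; rewrite ger0_norm ?subr_ge0 ?(ltW t't)// => small.
  rewrite distrC; apply: time => //; exact: ltW.
rewrite -[X in `|X|](subrKA (control_value t' x)) (le_trans (ler_normD _ _))//.
rewrite (le_trans (lerD H (space t' x y t'T)))//.
have P1 : 0 <= Lam * `|t - t'| by exact: mulr_ge0.
have P2 : 0 <= (N1 + N2) * `|x - y| by exact: mulr_ge0.
move: P1 P2; move: (N1 + N2) Lam (`|t - t'|) (`|x - y|) => p q p' q' P1 P2.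
have -> : (p + q) * (p' + q') = p * p' + q * q' + (q * p' + p * q') by ring.
by rewrite lerDl addr_ge0.
Qed.

End control_problem.

(** * The value function of an equilibrium *)

Lemma dist1_ge0 (R : realType) n (m m' : probability (borel 'cV[R]_n) R) : (0 <= dist1 m m')%E.
Proof.
apply: le_ereal_inf_tmp => _ [pi _ <-]; apply: integral_ge0 => z _.
by rewrite lee_fin enorm_ge0.
Qed.

Lemma within_continuous_dist (R : realType) n (a b : R) (g : R -> 'cV[R]_n) :
  {within `[a, b], continuous g} -> forall s, s \in `[a, b] ->
  forall e, 0 < e -> exists2 r, 0 < r &
    forall s', s' \in `[a, b] -> `|s - s'| < r -> `|g s - g s'| < e.
Proof.
move=> /subspace_continuousP cg s sab e e0.
have /cvgrPdist_lt/(_ e e0) := cg s sab.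
rewrite near_withinE => /nbhs_ballP[r' /= r0 hr]; exists r' => // s' s'ab ss'.
exact: hr.
Qed.

Section mfg_value.
Context {R : realType} {d k : nat} {A : 'M[R]_d} {B : 'M[R]_(d, k)}.
Context {T : {posnum R}}.
Context {L : 'cV[R]_d -> 'cV[R]_k -> probability (borel 'cV[R]_d) R -> R}.
Context {G : 'cV[R]_d -> probability (borel 'cV[R]_d) R -> R} {C0 C1 C2 : R}.
Hypothesis hLG : standing_assumptions L G C0 C1 C2.
Context {alpha r : R} {m0 : probability (borel 'cV[R]_d) R}.
Hypothesis alpha1 : 1 < alpha.
Hypothesis m0_P : in_Pp alpha m0.
Variable eta : probability (borel (curve A B T)) R.
Hypothesis eta_P : P_m0 alpha m0 r eta.

Let flowP s : 0 <= s <= T%:num -> in_Pp 1 (flow eta s) :=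
  flow_P1 alpha1 eta_P m0_P (t := s).

Lemma L_flow_hoelder : exists2 K : R, 0 <= K & forall s s' x v,
  0 <= s <= T%:num -> 0 <= s' <= T%:num ->
  `|L x v (flow eta s) - L x v (flow eta s')| <= K * Num.sqrt `|s - s'|.
Proof.
have [K hK] := L_lipschitz hLG.
have [C Cge0 hC] := dist1_flow_hoelder alpha1 eta_P.
exists (`|K| * C) => [|s s' x v sT s'T]; first by rewrite mulr_ge0.
rewrite -lee_fin (le_trans (hK x v _ _ (flowP sT) (flowP s'T)))//.
apply: (@le_trans _ _ (`|K|%:E * dist1 (flow eta s) (flow eta s'))%E).
  by apply: lee_wpmul2r; [exact: dist1_ge0|rewrite lee_fin ler_norm].
rewrite -mulrA EFinM; apply: lee_wpmul2l; first by rewrite lee_fin.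
exact: hC.
Qed.

Lemma running_cost_measurable (a b : R) (u : R -> 'cV[R]_k) (g : R -> 'cV[R]_d) :
  0 <= a -> b <= T%:num -> measurable_fun `[a, b] (u : R -> borel 'cV[R]_k) ->
  {within `[a, b], continuous g} ->
  measurable_fun `[a, b] (fun s => L (g s) (u s) (flow eta s)).
Proof.
move=> a0 bT mu_ cg.
have abT s : s \in `[a, b] -> 0 <= s <= T%:num.
  by rewrite in_itv/= => /andP[as_ sb]; rewrite (le_trans a0 as_) (le_trans sb bT).
have [c [C [_ C_ge0 hC]]] := running_cost_bounds hLG.
have [K K_ge0 hK] := L_flow_hoelder.
apply: (@caratheodory_measurable _ _ _ _ (fun s v => L (g s) v (flow eta s))) => //.
  move=> s sab v; apply: differentiable_continuous.
  apply: (differentiable_uncurry_r (f := fun x v => L x v (flow eta s))).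
  by have [] := L_C2 hLG (flowP (abT s sab)); case.
move=> v s sab e e0.
set D := C * (1 + enorm v ^+ 2).
have D0 : 0 <= D by rewrite mulr_ge0// addr_ge0// sqr_ge0.
have e1 : 0 < e / (2 * (D + 1)) by rewrite divr_gt0// mulr_gt0// ltr_wpDl.
have [r1 r10 hr1] := within_continuous_dist cg sab e1.
pose q := e / (2 * (K + 1)).
have q0 : 0 < q by rewrite divr_gt0// mulr_gt0// ltr_wpDl.
exists (Num.min r1 (q ^+ 2)) => [|s' s'ab]; first by rewrite lt_min r10 exprn_gt0.
rewrite lt_min => /andP[ss1 ss2].
have [_ _ lip] := hC _ (flowP (abT s sab)).
have sT := abT s sab; have s'T := abT s' s'ab.
rewrite -(subrKA (L (g s') v (flow eta s))) (le_lt_trans (ler_normD _ _))//.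
have H1 := lip (g s) (g s') v; have H2 := hK s s' (g s') v sT s'T.
have H3 : D * `|g s - g s'| <= D * (e / (2 * (D + 1))).
  by rewrite ler_wpM2l// ltW// hr1.
have H4 : K * Num.sqrt `|s - s'| <= K * q.
  rewrite ler_wpM2l// [leRHS](_ : q = Num.sqrt (q ^+ 2)); last by rewrite sqrtr_sqr gtr0_norm.
  by rewrite ler_sqrt ?sqr_ge0// ltW.
have H5 : D * (e / (2 * (D + 1))) < e / 2.
  have -> : e / 2 = (D + 1) * (e / (2 * (D + 1))).
    by field; rewrite gt_eqF// ltr_wpDl.
  by rewrite ltr_pM2r// ltrDl.
have H6 : K * q < e / 2.
  have -> : e / 2 = (K + 1) * q.
    by rewrite /q; field; rewrite gt_eqF// ltr_wpDl.
  by rewrite ltr_pM2r// ltrDl.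
by rewrite [ltRHS](splitr e); apply: ltrD;
  [exact: (le_lt_trans (le_trans H1 H3))|exact: (le_lt_trans (le_trans H2 H4))].
Qed.

Let l s x v := L x v (flow eta s).
Let h x := G x (flow eta T%:num).

Lemma cost_control_cost (t : R) x u g : 0 <= t -> admissible A B T%:num t x u g ->
  cost L G eta t u g = (control_cost T%:num l h t u g)%:E.
Proof.
move=> t0 [iu [cg _]].
have [c [C [c0 C_ge0 hC]]] := running_cost_bounds hLG.
rewrite /cost /control_cost EFinD; congr (_ + _)%E.
rewrite /Rintegral fineK//; apply: integrable_fin_num => //.
apply: (@integrable_running_cost _ _ _ T%:num l C _ _ t T%:num u g) => //.
  by move=> s y v /flowP/hC[_ + _]; exact.
exact: running_cost_measurable.
Qed.

Lemma control_value_function (t : R) x : 0 <= t <= T%:num ->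
  value_function L G eta t x = (control_value A B T%:num l h t x)%:E.
Proof.
move=> tT; have /andP[t0 _] := tT.
have [Z [Z0 dZ]] := fundamental_matrix A.
have [c [C [c0 C_ge0 hC]]] := running_cost_bounds hLG.
have [M hM] := G_bounded hLG.
have T1 : 0 <= T%:num <= T%:num by rewrite lexx ltW.
rewrite /value_function /control_value -ereal_inf_EFin.
- congr ereal_inf; apply/seteqP; split=> [_ [u [g [iu tg ->]]]|_ [_ [u [g [[iu tg] ->]]] <-]].
    exists (control_cost T%:num l h t u g); first by exists u, g.
    by rewrite (cost_control_cost t0 (conj iu tg)).
  by exists u, g; split => //; rewrite (cost_control_cost t0 (conj iu tg)).
- apply: (@control_costs_lbound _ _ _ A B T%:num l h c C M) => //.
  + by move=> s y v /flowP/hC[+ _ _]; exact.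
  + by move=> s y v /flowP/hC[_ + _]; exact.
  + exact: running_cost_measurable.
  + by move=> y; exact/hM/flowP.
- apply: (control_costs_nonempty B T%:num l h Z0 dZ).
Qed.

Lemma mxsum_fundamental_bounded (Z : R -> 'M[R]_d) :
  (forall (s : R) i j, is_derive s (1 : R) (fun t => Z t i j) ((A *m Z s) i j)) ->
  exists kappa, forall s, 0 <= s <= T%:num -> mxsum (Z s) <= kappa.
Proof.
move=> dZ.
have cZ : continuous (fun s => mxsum (Z s)).
  move=> s; apply: cvg_big => [|i _]; first exact: add_continuous.
  apply: cvg_big => [|j _]; first exact: add_continuous.
  apply: cvg_norm; apply: differentiable_continuous; apply/derivable1_diffP.
  by have [] := dZ s i j.
have [s0 _ H] := EVT_max (ltW (gt0 T)) (continuous_subspaceT cZ).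
by exists (mxsum (Z s0)) => s sT; apply: H; rewrite in_itv.
Qed.

Lemma value_function_local_lipschitz (X : R) : exists2 N : R, 0 <= N &
  forall t t' x y, 0 <= t <= T%:num -> 0 <= t' <= T%:num ->
  `|x| <= X -> `|y| <= X -> mxsum A * `|t - t'| <= 2^-1 ->
  `|fine (value_function L G eta t x) - fine (value_function L G eta t' y)| <=
    N * (`|t - t'| + `|x - y|).
Proof.
have [Z [Z0 dZ]] := fundamental_matrix A.
have [kappa hkappa] := mxsum_fundamental_bounded dZ.
have [c [C [c0 C_ge0 hC]]] := running_cost_bounds hLG.
have [M hM] := G_bounded hLG.
have T1 : 0 <= T%:num <= T%:num by rewrite lexx ltW.
have [dG _ [K hK] _] := G_C1b hLG (flowP T1).
have K0 : 0 <= K by apply: le_trans (hK 0); exact: enorm_ge0.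
have [|||||||N N0 HN] := @control_value_local_lipschitz _ _ _ A B T%:num l h
    c C M (d%:R * K) c0 C_ge0 _ _ _ _ _ _ _ Z Z0 dZ kappa hkappa X.
- by rewrite mulr_ge0.
- by move=> s y v /flowP/hC[+ _ _]; exact.
- by move=> s y v /flowP/hC[_ + _]; exact.
- by move=> s y z v /flowP/hC[_ _]; exact.
- exact: running_cost_measurable.
- by move=> y; exact/hM/flowP.
- exact: grad_bound_lipschitz dG hK.
exists N => // t t' x y tT t'T xX yX small.
by rewrite !control_value_function//=; exact: HN.
Qed.

End mfg_value.

Theorem theorem5p4 (R : realType) (d k : nat) (A : 'M[R]_d) (B : 'M[R]_(d, k))
    (T : {posnum R})
    (L : 'cV[R]_d -> 'cV[R]_k -> probability (borel 'cV[R]_d) R -> R)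
    (G : 'cV[R]_d -> probability (borel 'cV[R]_d) R -> R) (C0 C1 C2 : R)
    (hLG : standing_assumptions L G C0 C1 C2)
    (alpha : R) (halpha : 1 < alpha)
    (m0 : probability (borel 'cV[R]_d) R) (hm0 : in_Pp alpha m0)
    (r0 : R) (hr0 : admissible_radius A B T L G alpha m0 r0)
    (r : R) (hr : r0 <= r)
    (eta : probability (borel (curve A B T)) R)
    (heta : equilibrium L G alpha m0 r eta) :
  locally_lipschitz (`[0, T%:num] `*` [set: 'cV[R]_d])
    (fun p : R * 'cV[R]_d => value_function L G eta p.1 p.2).
Proof.
have [eta_P _] := heta.
split=> [[t x] [/= tT _]|[t0 x0] [/= t0T _]].
  by rewrite (control_value_function hLG halpha hm0 eta_P)// -in_itv.
have [N N0 HN] := value_function_local_lipschitz hLG halpha hm0 eta_P (`|x0| + 1).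
set a := mxsum A in HN; have a0 : 0 <= a by exact: mxsum_ge0.
pose r1 := Num.min 1 (4 * (a + 1))^-1.
have r10 : 0 < r1 by rewrite lt_min ltr01 invr_gt0 mulr_gt0// ltr_wpDl.
exists (ball (t0, x0) r1); first exact: nbhsx_ballx.
apply: (@klipschitzW _ _ _ (2 * N)).
  apply: (@globally_properfilter _ _ ((t0, x0), (t0, x0))).
  by split; split => //=; exact: ballxx.
move=> [[t x] [t' y]] [/= [[Bt Bx] [tT _]] [[Bt' By] [t'T _]]].
have inX z : ball x0 r1 z -> `|z| <= `|x0| + 1.
  rewrite -ball_normE/= => Bz; rewrite -[z](subrK x0) addrC.
  rewrite (le_trans (ler_normD _ _))// lerD2l distrC (le_trans (ltW Bz))//.
  by rewrite ge_min lexx.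
have small : a * `|t - t'| <= 2^-1.
  have tt' : `|t - t'| <= 2 * (4 * (a + 1))^-1.
    rewrite -(subrKA t0) (le_trans (ler_normD _ _))// mulr2n mulrDl !mul1r lerD//.
      by rewrite distrC (le_trans (ltW Bt))// ge_min lexx orbT.
    by rewrite (le_trans (ltW Bt'))// ge_min lexx orbT.
  apply: (le_trans (ler_wpM2l a0 tt')).
  rewrite invfM mulrA mulrA -ler_pdivlMr ?invr_gt0 ?ltr_wpDl// invrK.
  by lra.
apply: (le_trans (HN t t' x y tT t'T (inX x Bx) (inX y By) small)).
rewrite [2 * N]mulrC -mulrA ler_wpM2l// mulr2n mulrDl !mul1r.
by rewrite lerD// [leRHS]prod_normE le_max lexx ?orbT.
Qed.
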